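(* Let $f$ be a nonconstant locally integrable function on $\mathbb{R}^n$ such that $Mf$ is not identically infinite, and let $w\in A_\infty$ be a weight on $\mathbb{R}^n$. (1) There exist constants $c_1,c_2>0$ depending only on $n$ such that $$w \left( \left\{ x\in Q : \frac{Mf(x) - \operatorname{ess\,inf}_{Q} Mf }{M^\# f(x)} > t \right\} \right) \le c_1 e^{-\frac{c_2 t}{[w]_{A_\infty}}}\, w(Q)$$ for all $t>0$ and all cubes $Q$. That is, there is a constant $c_n$ depending only on $n$ such that for all cubes $Q$, $$\left\| \frac{Mf - \operatorname{ess\,inf}_{Q} Mf }{M^\# f}\right\|_{\exp L \left(Q , \frac{w(x)\, dx}{w(Q)}\right)} \le c_n [w]_{A_\infty}.$$ (2) There exist constants $c_1,c_2>0$ depending only on $n$ such that for every cube $Q$ and all $\lambda,\gamma>0$ the following good-lambda inequality holds: $$w\left( \left\{ x\in Q : Mf(x) - \operatorname{ess\,inf}_{Q} Mf > \lambda,\ M^\# f(x) \le \gamma \lambda \right\} \right) \le c_1 e^{-\frac{c_2 }{ [w]_{A_\infty} \gamma}}\, w(Q).$$ In both parts the constants are independent of $f$ and $w$.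
   Context: Cubes are cubes in $\mathbb{R}^n$ with sides parallel to the coordinate axes; $|E|$ is Lebesgue measure and $f_Q=\frac{1}{|Q|}\int_Q f$. ''Nonconstant'' means not almost everywhere equal to a constant. The (uncentered) Hardy–Littlewood maximal function is $Mf(x)=\sup_{Q\ni x}\frac{1}{|Q|}\int_Q |f(y)|\,dy$ and the sharp maximal function is $M^\# f(x)=\sup_{Q\ni x}\frac{1}{|Q|}\int_Q |f(y)-f_Q|\,dy$, the suprema being over all cubes $Q$ containing $x$. A weight is a locally integrable function $w$ with $w>0$ a.e.; $w(E)=\int_E w$. The Fujii–Wilson constant is $[w]_{A_\infty}=\sup_Q\frac{1}{w(Q)}\int_Q M(w\chi_Q)(x)\,dx$, the supremum over all cubes, and $w\in A_\infty$ means $[w]_{A_\infty}<\infty$. The essential infimum is with respect to Lebesgue measure. For a probability measure $\mu$ on $Q$, $\|g\|_{\exp L(Q,\mu)}=\inf\{\lambda>0:\int_Q (e^{|g|/\lambda}-1)\,d\mu\le 1\}$ is the usual Luxemburg norm. *)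

(* Defs.v *)
From HB Require Import structures.
From mathcomp Require Import all_boot all_order all_algebra.
From mathcomp Require Import all_classical all_reals all_analysis.
From mathcomp Require Import ess_sup_inf.

Set Implicit Arguments.
Unset Strict Implicit.
Unset Printing Implicit Defensive.
Import Order.TTheory GRing.Theory Num.Theory.
Import numFieldNormedType.Exports.

Local Open Scope classical_set_scope.
Local Open Scope ring_scope.

Lemma product_sigma_finite (R : realType) d1 d2 (T1 : measurableType d1)
    (T2 : measurableType d2) (m1 : {sigma_finite_measure set T1 -> \bar R})
    (m2 : {sigma_finite_measure set T2 -> \bar R}) :
  sigma_finite [set: T1 * T2] (m1 \x m2)%E.
Proof.
have /sigma_finiteP[F [TF ndF Foo]] := sigma_finiteT m1.
have /sigma_finiteP[G [TG ndG Goo]] := sigma_finiteT m2.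
exists (fun n => F n `*` G n).
  rewrite -setXTT TF TG predeqE => -[x y]; split.
    move=> [/= [n _ Fnx] [k _ Gky]]; exists (maxn n k) => //; split.
    - by move: x Fnx; exact/subsetPset/ndF/leq_maxl.
    - by move: y Gky; exact/subsetPset/ndG/leq_maxr.
  by move=> [n _ []/= ? ?]; split; exists n.
move=> k; have [? ?] := Foo k; have [? ?] := Goo k.
split; first exact: measurableX.
by rewrite product_measure1E// lte_mul_pinfty// ge0_fin_numE.
Qed.

Section lebesgue_prod.
Context {R : realType}.
Local Open Scope ereal_scope.

Definition tcons n (p : measurableTypeR R * n.-tuple (measurableTypeR R)) :
  n.+1.-tuple (measurableTypeR R) := [tuple of p.1 :: p.2].

(* The n-fold product of the Lebesgue measure of R, on the product
   sigma-algebra of R^n. *)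
Fixpoint lebesgue_prod (n : nat) :
    set (n.-tuple (measurableTypeR R)) -> \bar R :=
  match n with
  | 0%N => \d_[tuple]
  | m.+1 => pushforward (lebesgue_measure \x @lebesgue_prod m) (@tcons m)
  end.

Lemma measurable_tcons n : measurable_fun [set: _] (@tcons n).
Proof. by apply: measurable_cons; [exact: measurable_fst|exact: measurable_snd]. Qed.

Section leb_tcons.
Variables (n : nat).
Variable m : {sigma_finite_measure set (n.-tuple (measurableTypeR R)) -> \bar R}.

Let leb_tcons : set (n.+1.-tuple (measurableTypeR R)) -> \bar R :=
  pushforward (lebesgue_measure \x m) (@tcons n).

HB.instance Definition _ := Measure.copy leb_tcons
  (measure_function_pushforward__canonical__measure_function_Measure
    (lebesgue_measure \x m) (@measurable_tcons n)).

Let sigma_finite_leb_tcons : sigma_finite setT leb_tcons.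
Proof.
have [F TF Foo] := product_sigma_finite (@lebesgue_measure R) m.
pose uncons (t : n.+1.-tuple (measurableTypeR R)) :=
  (thead t, [tuple of behead t]).
have muncons : measurable_fun [set: _] uncons.
  apply/measurable_fun_pairP; split; last exact: measurable_behead.
  exact: measurable_tnth.
have consK : cancel (@tcons n) uncons.
  by move=> [x t]; congr pair; exact: val_inj.
exists (fun k => uncons @^-1` F k).
  by rewrite -preimage_bigcup -TF preimage_setT.
move=> k; have [mF Fk] := Foo k; split.
  by rewrite -[X in measurable X]setTI; exact: muncons.
rewrite /leb_tcons /pushforward -comp_preimage.
by rewrite (_ : uncons \o @tcons n = id) //; apply/funext => x; exact: consK.
Qed.

Let sfinite_leb_tcons : sfinite_measure leb_tcons.
Proof. exact: sfinite_measure_sigma_finite. Qed.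

HB.instance Definition _ := @isSFinite.Build _ _ _ leb_tcons sfinite_leb_tcons.

HB.instance Definition _ :=
  @isSigmaFinite.Build _ _ _ leb_tcons sigma_finite_leb_tcons.

Lemma leb_tcons_sigma_finite_measure :
  exists m' : {sigma_finite_measure set (n.+1.-tuple (measurableTypeR R)) ->
                \bar R},
    m' = pushforward (lebesgue_measure \x m) (@tcons n) :> (set _ -> \bar R).
Proof. by exists leb_tcons. Qed.

End leb_tcons.

Lemma lebesgue_prodP n :
  exists m : {sigma_finite_measure set (n.-tuple (measurableTypeR R)) ->
               \bar R},
    m = @lebesgue_prod n :> (set _ -> \bar R).
Proof.
elim: n => [|n [m mE]]; first by exists \d_[tuple].
have [m' m'E] := leb_tcons_sigma_finite_measure m.
by exists m'; rewrite m'E /= -mE.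
Qed.

Let lebesgue_prod0 n : @lebesgue_prod n set0 = 0.
Proof. by have [m <-] := lebesgue_prodP n. Qed.

Let lebesgue_prod_ge0 n A : 0 <= @lebesgue_prod n A.
Proof. by have [m <-] := lebesgue_prodP n. Qed.

Let lebesgue_prod_sigma_additive n : semi_sigma_additive (@lebesgue_prod n).
Proof.
by have [m <-] := lebesgue_prodP n; exact: measure_semi_sigma_additive.
Qed.

HB.instance Definition _ n := isMeasure.Build _ _ _ (@lebesgue_prod n)
  (@lebesgue_prod0 n) (@lebesgue_prod_ge0 n) (@lebesgue_prod_sigma_additive n).

Let lebesgue_prod_sigma_finite n : sigma_finite setT (@lebesgue_prod n).
Proof. by have [m <-] := lebesgue_prodP n; exact: sigma_finiteT. Qed.

HB.instance Definition _ n := Measure_isSigmaFinite.Build _ _ _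
  (@lebesgue_prod n) (@lebesgue_prod_sigma_finite n).

Lemma measurable_box n (A : 'I_n -> set (measurableTypeR R)) :
  (forall i, measurable (A i)) ->
  measurable [set x : n.-tuple (measurableTypeR R) | forall i, A i (tnth x i)].
Proof.
move=> mA; rewrite (_ : [set x | _] = \bigcap_(i in [set: 'I_n])
    ((fun x : n.-tuple (measurableTypeR R) => tnth x i) @^-1` A i)).
  apply: fin_bigcap_measurable => // i _.
  by rewrite -[X in measurable X]setTI; exact: measurable_tnth.
by apply/seteqP; split=> x H i //=; exact: H.
Qed.

Lemma lebesgue_prod_box n (A : 'I_n -> set (measurableTypeR R)) :
  (forall i, measurable (A i)) ->
  @lebesgue_prod n [set x | forall i, A i (tnth x i)] =
  \prod_(i < n) lebesgue_measure (A i).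
Proof.
elim: n A => [|n IH] A mA.
  rewrite big_ord0 /= diracE (_ : _ \in _ = true) //.
  by apply/mem_set => -[].
rewrite big_ord_recl -IH //.
have [m mE] := lebesgue_prodP n.
rewrite /= /pushforward -mE -product_measure1E //.
  congr (_ _); apply/seteqP; split => -[x t] /=.
    move=> H; split; first by have := H ord0; rewrite tnth0.
    by move=> i; have := H (lift ord0 i); rewrite tnthS.
  move=> [Hx Ht] i; case: (unliftP ord0 i) => [j ->|->].
    by rewrite tnthS; exact: Ht.
  by rewrite tnth0.
by apply: (measurable_box (A := fun i => A (lift ord0 i))) => i; exact: mA.
Qed.

End lebesgue_prod.

(* R^n, with the sigma-algebra of Lebesgue measurable sets. *)
Definition Rn (R : realType) (n : nat) :=
  caratheodory_type ((@lebesgue_prod R n)^*)%mu.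
HB.instance Definition _ R n := Measurable.on (Rn R n).

Definition leb (R : realType) (n : nat) : set (Rn R n) -> \bar R :=
  @completed_measure_extension _ _ _ (@lebesgue_prod R n).
HB.instance Definition _ R n := Measure.on (@leb R n).

Section definitions.
Context {R : realType} {n : nat}.
Local Open Scope ereal_scope.
Local Notation Rn := (Rn R n).
Local Notation mu := (@leb R n).
Implicit Types (f w : Rn -> R) (g : Rn -> \bar R) (x : Rn) (Q : set Rn).

(* Cubes are taken closed and non-degenerate. *)
Definition cube (a : Rn) (l : R) : set Rn :=
  [set x | forall i, ((tnth a i : R) <= tnth x i <= (tnth a i : R) + l)%R].

Definition is_cube Q := exists a l, (0 < l)%R /\ Q = cube a l.

Let side (a : Rn) (l : R) (i : 'I_n) : set (measurableTypeR R) :=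
  [set` `[(tnth a i : R), (tnth a i : R) + l]%R].

Let measurable_side a l i : measurable (side a l i).
Proof. exact: measurable_itv. Qed.

Let cubeE a l : cube a l =
  [set x : n.-tuple (measurableTypeR R) | forall i, side a l i (tnth x i)].
Proof.
by apply/seteqP; split => x H i; have := H i; rewrite /side /= in_itv.
Qed.

Lemma measurable_cube Q : is_cube Q -> measurable Q.
Proof.
move=> [a [l [_ ->]]]; apply: caratheodory_measurable_mu_ext.
by rewrite cubeE; exact: measurable_box.
Qed.

Lemma leb_cube a l : (0 < l)%R -> mu (cube a l) = (l ^+ n)%:E.
Proof.
move=> l0; rewrite cubeE.
transitivity
  (@lebesgue_prod R n [set x | forall i, side a l i (tnth x i)]).
  by apply: (@measurable_mu_extE _ _ _ (@lebesgue_prod R n)); exact: measurable_box.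
rewrite lebesgue_prod_box//.
transitivity (\prod_(i < n) l%:E).
  apply: eq_bigr => i _; rewrite lebesgue_measure_itv/= lte_fin ltrDl l0.
  by rewrite -EFinD addrAC subrr add0r.
by rewrite prodEFin prodr_const card_ord.
Qed.

Definition to_rV (x : Rn) : 'rV[R]_n := (\row_i (tnth x i : R))%R.

(* R^n carries no topology here: compactness is that of the image in 'rV[R]_n. *)
Definition loc_integrable f :=
  measurable_fun [set: Rn] f /\
  forall K : set Rn, compact (to_rV @` K) ->
    \int[mu]_(x in K) `|f x|%:E < +oo.

Definition nonconstant f := ~ exists c : R, \forall x \ae mu, f x = c.

Definition avg f Q := (mu Q)^-1 * \int[mu]_(x in Q) (f x)%:E.

Definition maximal f x : \bar R :=
  ereal_sup [set (mu Q)^-1 * \int[mu]_(y in Q) `|f y|%:E |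
             Q in [set Q | is_cube Q /\ Q x]].

Definition sharp_maximal f x : \bar R :=
  ereal_sup [set (mu Q)^-1 * \int[mu]_(y in Q) `|(f y)%:E - avg f Q| |
             Q in [set Q | is_cube Q /\ Q x]].

Definition weight w :=
  loc_integrable w /\ \forall x \ae mu, (0 < w x)%R.

Definition wmeas w (E : set Rn) : \bar R := \int[mu]_(x in E) (w x)%:E.

Definition Ainfty_const w : \bar R :=
  ereal_sup [set (wmeas w Q)^-1 *
                 \int[mu]_(x in Q) maximal (fun y => w y * \1_Q y)%R x |
             Q in is_cube].

Definition Ainfty w := Ainfty_const w < +oo.

Definition ess_inf_cube Q (cQ : is_cube Q) g : \bar R :=
  ess_inf (mrestr mu (measurable_cube cQ)) g.

(* The Luxemburg norm of exp L (Q, w(x) dx / w(Q)). *)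
Definition expL_norm w Q g : \bar R :=
  ereal_inf [set l%:E | l in [set l : R | (0 < l)%R /\
    \int[mu]_(x in Q)
      ((expeR (`|g x| / l%:E) - 1) * ((w x)%:E / wmeas w Q)) <= 1]].

End definitions.

(* Main.v *)
Require Import Defs.
From mathcomp Require Import all_boot all_order all_algebra.
From mathcomp Require Import ring lra.
From mathcomp Require Import all_classical all_reals all_analysis.
From mathcomp Require Import measurable_realfun ess_sup_inf.

(** Fix a cube Q.  A dyadic descendant u of a cube S stops S when the average of
|f - f_S| over u is more than twice its average over S.  Starting from Q and
replacing S by u at each stop, every point x of Q meets a number N(x) of
stopping cubes.  The theorem combines two facts about N.

Pointwise, Mf(x) - inf_Q Mf <= C_n (N(x) + 1) M#f(x).  Between two stops the
averages of f move by at most 2 osc(S) <= 2 M#f(x), and at a stop by at most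
2^n times that, so |f_u - f_Q| <= 2^(n+1) (N(x) + 1) M#f(x) for every dyadic u
containing x (leaf_path).  Any other cube P containing x compares with these: if
P is smaller than Q, then P and a dyadic u of similar size, both containing x,
lie in a cube of similar size, on which f oscillates by at most M#f(x); if P is
larger than Q, then P and Q lie in a cube of similar size, over which the
average of |f| is at most inf_Q Mf (mean_norm_le_path).

On average, the integral of z^N against w over Q is at most (3/2) w(Q) for
z = 1 + 1/(8 [w]).  The stopping cubes directly below a stopping cube T cover at
most half of T, so the sum of w(T) = w_T |T| over the stopping cubes T inside S
is at most twice the sum of w_T |T minus the next generation|, hence at most
twice the integral of M(w 1_S) over S, which is at most 2 [w] w(S)
(stop_sum_le).  This Carleson packing condition, valid inside every stopping
cube, makes z^N integrable: z^N - 1 is z - 1 times the sum, over the stopping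
cubes T containing x, of z to the number of stopping cubes strictly inside T,
and an induction on the depth bounds each of these inner integrals by 2 w(T)
(leaf_sum_le_stop_sum).  It is this argument, and not a reverse Holder
inequality, that yields the linear dependence on [w].

So H = z^(N + 1) satisfies: the integral of H over Q against w is at most
2 w(Q), and Mf(x) <= inf_Q Mf + t M#f(x) as soon as H(x) <= exp(t / (C_n [w]))
(exponential_majorant).  The decay of the level sets of the quotient is
Chebyshev's inequality for H (exponential_tail), the good-lambda inequality is
the same estimate with t = 1 / gamma, and the bound on the exp L norm says that
exp(|g| / (C_n [w])) <= H almost everywhere, where g is the quotient
(exponential_norm).

The exploration of the dyadic tree is stopped at a finite depth K, where
everything is a finite sum (leaf_sum), and H is the supremum over K.  The cubes
being closed, a point on a face lies in several cubes of the same generation;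
z^N is then replaced by the sum of z^(number of stops) over all the branches of
the tree that contain x, which only matters on a null set.  The functions Mf,
M#f and M(w 1_S) are never shown to be measurable: the integral of an arbitrary
nonnegative function is a supremum over the simple functions below it, and
monotonicity is the only property of it that is used. *)

Set Implicit Arguments.
Unset Strict Implicit.
Unset Printing Implicit Defensive.
Import Order.TTheory GRing.Theory Num.Theory.
Import numFieldNormedType.Exports.

Local Open Scope classical_set_scope.
Local Open Scope ring_scope.

(** * Stopping nodes in a finite tree *)

Section stopping_tree.
Context {R : realFieldType} {X : Type} {E : finType}.
Variables (child : X -> E -> X) (stop : X -> X -> bool) (ok : X -> Prop).
Hypothesis ok_child : forall v e, ok v -> ok (child v e).

(** The total weight of the stopping nodes in the K generations below v, when S
    is the last stopping node met on the way to v. *)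
Fixpoint stop_sum (W : X -> R) (K : nat) (v S : X) : R :=
  if K is K'.+1 then
    \sum_e (let u := child v e in
      if stop u S then W u + stop_sum W K' u u else stop_sum W K' u S)
  else 0.

(** A sum over the nodes u that lie K generations below v; the term of u is
    m u T, where T is the last stopping node on the way to u, multiplied by z
    to the number of stops between v and u. *)
Fixpoint leaf_sum (z : R) (m : X -> X -> R) (K : nat) (v S : X) : R :=
  if K is K'.+1 then
    \sum_e (let u := child v e in
      if stop u S then z * leaf_sum z m K' u u else leaf_sum z m K' u S)
  else m v S.

Lemma leaf_sum_ge0 z m K v S : 0 <= z -> (forall u T, 0 <= m u T) ->
  0 <= leaf_sum z m K v S.
Proof.
move=> z0 m0; elim: K v S => [|K IH] v S //=.
by apply: sumr_ge0 => e _; case: ifP => _ //; rewrite mulr_ge0.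
Qed.

Lemma eq_leaf_sum z m m' K v S : (forall u T, ok u -> ok T -> m u T = m' u T) ->
  ok v -> ok S ->
  leaf_sum z m K v S = leaf_sum z m' K v S.
Proof.
move=> mm'; elim: K v S => [|K IH] v S okv okS /=; first exact: mm'.
by apply: eq_bigr => e _; case: ifP => _; rewrite IH//; try exact: ok_child.
Qed.

(** A leaf either keeps its last stopping node or becomes one when the tree is
    explored one generation further, hence the two bounds that are asked of one
    of its children. *)
Lemma leaf_sum_leS z m K v S : 1 <= z -> (forall u T, 0 <= m u T) ->
  (forall u T, exists2 e, m u T <= m (child u e) T
    & m u T <= m (child u e) (child u e)) ->
  leaf_sum z m K v S <= leaf_sum z m K.+1 v S.
Proof.
move=> z1 m0 mle; have z0 : 0 <= z by rewrite (le_trans _ z1).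
elim: K v S => [|K IH] v S.
  have [e me1 me2] := mle v S.
  rewrite /= (bigD1 e)//= -[leLHS]addr0 lerD//.
    case: ifP => _ //; apply: (le_trans me2).
    by rewrite ler_peMl.
  by apply: sumr_ge0 => e' _; case: ifP => _ //; rewrite mulr_ge0.
rewrite [leLHS]/= [leRHS]/=; apply: ler_sum => e _; case: ifP => _; last exact: IH.
by rewrite ler_wpM2l//; exact: IH.
Qed.

Variables (W vol : X -> R) (sg : X -> X -> R).
Hypothesis W_ge0 : forall v, 0 <= W v.
Hypothesis vol_gt0 : forall v, ok v -> 0 < vol v.
Hypothesis vol_child : forall v, ok v -> \sum_e vol (child v e) = vol v.
Hypothesis W_child : forall v, ok v -> \sum_e W (child v e) <= W v.
Hypothesis sg_ge0 : forall v S, 0 <= sg v S.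
Hypothesis sg_child : forall v S, ok v -> \sum_e sg (child v e) S <= sg v S.
Hypothesis sg_diag : forall S, ok S -> sg S S <= vol S.
Hypothesis stop_sg : forall v S, ok v -> stop v S -> 2 * vol v <= sg v S.

Let avgW S := W S / vol S.
Let B := leaf_sum 1 (fun v S => avgW S * vol v).

Let avgW_ge0 S : ok S -> 0 <= avgW S.
Proof. by move=> okS; rewrite divr_ge0// ltW// vol_gt0. Qed.

(** The extra term is a potential: it is twice the volume still available below S
    minus the part of it already charged by sg.  It is superadditive over the
    children, and negative at a node that stops, so that dropping it there leaves
    room for the potential of the new stopping node, which is at least W u. *)
Lemma stop_sum_le_leaf_sum_aux K v S :
  ok v -> ok S ->
  stop_sum W K v S + (2 * vol v - sg v S) * avgW S <= 2 * B K v S.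
Proof.
rewrite /B; elim: K v S => [|K IH] v S okv okS.
  have : 0 <= sg v S * avgW S.
    by rewrite mulr_ge0 ?avgW_ge0.
  by rewrite /=; lra.
pose t u := (2 * vol u - sg u S) * avgW S.
have tv : (2 * vol v - sg v S) * avgW S <= \sum_e t (child v e).
  rewrite -mulr_suml ler_wpM2r ?avgW_ge0// big_split/= -mulr_sumr vol_child// lerD2l.
  by rewrite sumrN lerN2 sg_child.
apply: (le_trans (lerD (lexx _) tv)); rewrite /= -big_split/= mulr_sumr.
apply: ler_sum => e _; set u := child v e; have oku : ok u by exact: ok_child.
case: ifP => su; last exact: IH.
rewrite mul1r; have := IH u u oku oku; apply: le_trans.
rewrite [W u + _]addrC -addrA lerD2l.
have tu : t u <= 0 by apply: mulr_le0_ge0; rewrite ?avgW_ge0// subr_le0 stop_sg.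
apply: (@le_trans _ _ (W u)); first by rewrite gerDl.
rewrite -[leLHS](@mulfVK _ (vol u)) ?gt_eqF ?vol_gt0// -/(avgW u) [leLHS]mulrC.
by rewrite ler_wpM2r ?avgW_ge0//; have := sg_diag oku; lra.
Qed.

(** The hypotheses on sg bound the volume of the stopping nodes
    directly below S by half the volume of S, so each W T = avg_T W * vol T is
    paid twice over by the part of T that lies below no further stop. *)
Lemma stop_sum_le_leaf_sum K S : ok S -> stop_sum W K S S + W S <= 2 * B K S S.
Proof.
move=> okS; apply: le_trans (stop_sum_le_leaf_sum_aux K okS okS).
rewrite lerD2l -[leLHS](@mulfVK _ (vol S)) ?gt_eqF ?vol_gt0// [leLHS]mulrC.
by rewrite ler_wpM2r ?avgW_ge0//; have := sg_diag okS; lra.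
Qed.

(** Khas'minskii's argument: z^N is expanded along the stopping nodes, each of
    which contributes z - 1 times the same sum started from that node.  The
    induction on the depth bounds the latter by 2 W u, thanks to the packing
    condition with constant 2 D. *)
Lemma leaf_sum_le_stop_sum z (D : R) K v S : 1 <= z -> ok v -> ok S ->
  4 * (z - 1) * D <= 1 ->
  (forall K S, ok S -> stop_sum W K S S <= 2 * D * W S) ->
  leaf_sum z (fun v _ => W v) K v S <= W v + 2 * (z - 1) * stop_sum W K v S.
Proof.
move=> z1 + + zD HD; elim: K v S => [|K IH] v S okv okS.
  by rewrite /= mulr0 addr0.
rewrite /= mulr_sumr; apply: (@le_trans _ _
  (\sum_e (W (child v e) + 2 * (z - 1) *
    (let u := child v e in
     if stop u S then W u + stop_sum W K u u else stop_sum W K u S)))); last first.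
  by rewrite big_split/= lerD2r W_child.
apply: ler_sum => e _ /=; set u := child v e; have oku : ok u by exact: ok_child.
case: ifP => su; last exact: IH.
have IHu := IH u u oku oku; have HDu := HD K u oku.
set L := leaf_sum _ _ _ _ _ in IHu *; set A := stop_sum _ _ _ _ in IHu HDu *.
have L2 : L <= 2 * W u.
  apply: (le_trans IHu); have : 2 * (z - 1) * A <= W u; last lra.
  have z10 : 0 <= 2 * (z - 1) by lra.
  apply: (le_trans (ler_wpM2l z10 HDu)).
  rewrite mulrA -[leRHS]mul1r ler_wpM2r//; lra.
have : (z - 1) * L <= (z - 1) * (2 * W u) by rewrite ler_wpM2l//; lra.
lra.
Qed.

End stopping_tree.

(** * Comparing integrals of nonmeasurable functions *)

Section integral_nonmeasurable.
Local Open Scope ereal_scope.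
Context d (T : measurableType d) (R : realType).
Variable mu : {measure set T -> \bar R}.
Implicit Types (D E : set T) (f g : T -> \bar R).

(** The integral of a nonnegative function is a supremum over simple functions
    below it, and dropping the negative part of f only increases its integral;
    this is why no measurability is involved. *)
Lemma le_integral_subset D E f g : E `<=` D ->
  (forall x, E x -> f x <= g x) -> (forall x, D x -> 0 <= g x) ->
  \int[mu]_(x in E) f x <= \int[mu]_(x in D) g x.
Proof.
move=> ED fg g0; rewrite integralE.
apply: (@le_trans _ _ (\int[mu]_(x in E) f^\+ x)).
  by rewrite geeDl// oppe_le0 integral_ge0.
rewrite !ge0_integralE//; apply: ereal_sup_le => _ [h hf <-]; exists h => // x.
apply: (le_trans (hf x)); rewrite /patch; case: ifPn => [/set_mem Ex|_].
  have Dx := ED _ Ex; by rewrite mem_set// funeposE ge_max fg// g0.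
by case: ifPn => // /set_mem/g0.
Qed.

Lemma ae_le_integral_lower D f g : measurable D -> measurable_fun D f ->
  (forall x, D x -> 0 <= f x) -> (forall x, D x -> 0 <= g x) ->
  {ae mu, forall x, D x -> f x <= g x} ->
  \int[mu]_(x in D) f x <= \int[mu]_(x in D) g x.
Proof.
move=> mD mf f0 g0 [N [mN N0 fgN]]; rewrite (ge0_negligible_integral mN)//.
apply: le_integral_subset => // x [Dx /= Nx]; apply: contrapT => fg.
by apply: Nx; apply: fgN => /= /(_ Dx).
Qed.

(** The value of g is raised to +oo on the exceptional null set, which makes the
    comparison hold everywhere without changing the integral of g. *)
Lemma ae_le_integral_upper D f g : measurable D -> measurable_fun D g ->
  (forall x, D x -> 0 <= g x) ->
  {ae mu, forall x, D x -> f x <= g x} ->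
  \int[mu]_(x in D) f x <= \int[mu]_(x in D) g x.
Proof.
move=> mD mg g0 [N [mN N0 fgN]].
pose h x := if x \in N then +oo else g x.
have hg x : ~ N x -> h x = g x by move=> Nx; rewrite /h memNset.
have h0 x : D x -> 0 <= h x by move=> Dx; rewrite /h; case: ifP => // _; exact: g0.
have mh : measurable_fun D h.
  apply: measurable_fun_if => //.
  - apply: (@measurable_fun_bool _ _ _ _ true); apply: measurableI => //.
    rewrite (_ : _ @^-1` _ = N)//; apply/seteqP; split => x /= xN.
      exact: set_mem.
    exact: mem_set.
  - by apply: measurable_funS mg.
apply: (@le_trans _ _ (\int[mu]_(x in D) h x)).
  apply: le_integral_subset => // x Dx; rewrite /h; case: ifPn => [_|]; first exact: leey.
  rewrite notin_setE => Nx; apply: contrapT => fg.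
  by apply: Nx; apply: fgN => /= /(_ Dx).
rewrite (ge0_negligible_integral mN)//; apply: le_integral_subset => //.
by move=> x [_ Nx]; rewrite hg.
Qed.

End integral_nonmeasurable.

(** * Geometry of dyadic cubes *)

Section cubes.
Context {R : realType} {n : nat}.
Local Notation Rn := (Rn R n).
Local Notation mu := (@leb R n).
Local Notation node := (Rn * R)%type.
Implicit Types (v u P S : node) (x : Rn).

(** Cubes are handled through the pair of their lowest corner and side. *)
Definition ncube (v : node) : set Rn := cube v.1 v.2.

Definition dyadic_child (v : node) (e : {ffun 'I_n -> bool}) : node :=
  ([tuple (tnth v.1 i : R) + (e i)%:R * (v.2 / 2) | i < n], v.2 / 2).

Lemma is_cube_ncube v : 0 < v.2 -> is_cube (ncube v).
Proof. by move=> v0; exists v.1, v.2. Qed.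

Lemma is_cubeP (Q : set Rn) : is_cube Q -> exists2 v, 0 < v.2 & Q = ncube v.
Proof. by move=> [a [l [l0 ->]]]; exists (a, l). Qed.

Lemma measurable_ncube v : 0 < v.2 -> measurable (ncube v).
Proof. by move=> v0; apply: measurable_cube; exact: is_cube_ncube. Qed.

Lemma leb_ncube v : 0 < v.2 -> mu (ncube v) = (v.2 ^+ n)%:E.
Proof. by move=> v0; exact: leb_cube. Qed.

Lemma ncubeP v x : ncube v x <-> forall i,
  (tnth v.1 i : R) <= tnth x i /\ (tnth x i : R) <= (tnth v.1 i : R) + v.2.
Proof. by split=> xv i; have /andP := xv i. Qed.

Lemma ncube_dyadic_childP v e x : ncube (dyadic_child v e) x <-> forall i,
  (tnth v.1 i : R) + (e i)%:R * (v.2 / 2) <= tnth x i /\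
  (tnth x i : R) <= (tnth v.1 i : R) + (e i)%:R * (v.2 / 2) + v.2 / 2.
Proof. by rewrite ncubeP; split=> xv i; have := xv i; rewrite /= tnth_mktuple. Qed.

Lemma ncube_dyadic_child_sub v e : 0 < v.2 -> ncube (dyadic_child v e) `<=` ncube v.
Proof.
move=> v0 x /ncube_dyadic_childP xe; apply/ncubeP => i.
by have := xe i; case: (e i) => /= -[h1 h2]; lra.
Qed.

Lemma ncube_dyadic_child_cover v x : ncube v x -> exists e, ncube (dyadic_child v e) x.
Proof.
move=> /ncubeP xv;
(* e i tells in which half of its side the i-th coordinate of x lies *)
exists [ffun i => (tnth v.1 i : R) + v.2 / 2 <= tnth x i].
apply/ncube_dyadic_childP => i; have [h1 h2] := xv i; rewrite ffunE.
by case: (leP ((tnth v.1 i : R) + v.2 / 2) (tnth x i : R)) => h3 /=; lra.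
Qed.

Lemma dyadic_child_side_gt0 v e : 0 < v.2 -> 0 < (dyadic_child v e).2.
Proof. by move=> v0; rewrite divr_gt0. Qed.

Lemma sum_dyadic_child_side v :
  \sum_(e : {ffun 'I_n -> bool}) (dyadic_child v e).2 ^+ n = v.2 ^+ n.
Proof.
rewrite /= sumr_const card_ffun card_bool card_ord expr_div_n.
by rewrite -[LHS]mulr_natr natrX mulfVK// expf_neq0// pnatr_eq0.
Qed.

(** The smaller of the two lowest corners works: a common point forces the
    corners to differ by at most one of the sides in each coordinate. *)
Lemma cube_hull P S x : ncube P x -> ncube S x -> 0 < P.2 -> 0 < S.2 ->
  exists2 U, U.2 = P.2 + S.2 & ncube P `<=` ncube U /\ ncube S `<=` ncube U.
Proof.
move=> /ncubeP Px /ncubeP Sx P0 S0.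
exists ([tuple Num.min (tnth P.1 i : R) (tnth S.1 i : R) | i < n], P.2 + S.2) => //.
by split=> y /ncubeP yP; apply/ncubeP => i; have [h1 h2] := yP i;
  have [h3 h4] := Px i; have [h5 h6] := Sx i;
  rewrite /= tnth_mktuple; case: (leP (tnth P.1 i : R) (tnth S.1 i : R)) => h /=; lra.
Qed.

Lemma measurable_slab v (i : 'I_n) (c : R) : 0 < v.2 ->
  measurable (ncube v `&` [set x | (tnth x i : R) = c]).
Proof.
move=> v0; apply: measurableI; first exact: measurable_ncube.
apply: caratheodory_measurable_mu_ext.
have := @measurable_tnth _ (measurableTypeR R) n i measurableT [set c].
by rewrite setTI; apply; exact: measurable_set1.
Qed.

Lemma slab_null v (i : 'I_n) (c : R) : 0 < v.2 ->
  mu (ncube v `&` [set x | (tnth x i : R) = c]) = 0%E.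
Proof.
move=> v0.
pose A (j : 'I_n) : set (measurableTypeR R) :=
  if j == i then [set c] else [set` `[(tnth v.1 j : R), (tnth v.1 j : R) + v.2]%R].
have mA j : measurable (A j).
  by rewrite /A; case: ifP => _; [exact: measurable_set1 | exact: measurable_itv].
have mB : measurable
    [set x : n.-tuple (measurableTypeR R) | forall j, A j (tnth x j)].
  exact: measurable_box.
have B0 : mu [set x : Rn | forall j, A j (tnth x j)] = 0%E.
  transitivity (@lebesgue_prod R n [set x | forall j, A j (tnth x j)]).
    by apply: (@measurable_mu_extE _ _ _ (@lebesgue_prod R n)).
  rewrite lebesgue_prod_box//; rewrite (bigD1 i)//= /A eqxx.
  by rewrite lebesgue_measure_set1 mul0e.
apply: (subset_measure0 _ _ _ B0).
- exact: measurable_slab.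
- exact: caratheodory_measurable_mu_ext.
- move=> x [xv xc] j; rewrite /A; case: eqP => [->//|_] /=.
  by rewrite in_itv /=; exact: xv.
Qed.

(** Two distinct closed children only meet inside a hyperplane that bisects
    their parent, and slab_null says that those are negligible. *)
Lemma dyadic_child_ae_disjoint v : 0 < v.2 ->
  {ae mu, forall x, forall e e' : {ffun 'I_n -> bool},
     ncube (dyadic_child v e) x -> ncube (dyadic_child v e') x -> e = e'}.
Proof.
move=> v0.
have : {ae mu, forall x, forall i : 'I_n, ncube v x ->
    (tnth x i : R) <> (tnth v.1 i : R) + v.2 / 2}.
  apply: filter_forall => i; exists (ncube v `&`
    [set x | (tnth x i : R) = (tnth v.1 i : R) + v.2 / 2]).
  split; [exact: measurable_slab|exact: slab_null|].
  by move=> x /= /not_implyP[xv /contrapT].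
apply: filterS => x xi e e' xe xe'; apply/ffunP => i.
have {}xi := xi i (ncube_dyadic_child_sub v0 xe).
move/ncube_dyadic_childP : xe => /(_ i); move/ncube_dyadic_childP : xe' => /(_ i).
by case: (e i); case: (e' i) => //= -[h1 h2] [h3 h4]; exfalso; apply: xi; lra.
Qed.

Lemma compact_ncube v : compact (@to_rV R n @` ncube v).
Proof.
pose A (i : 'I_n) := [set` `[(tnth v.1 i : R), (tnth v.1 i : R) + v.2]%R].
have -> : @to_rV R n @` ncube v = [set w : 'rV[R]_n | forall i, A i (w ord0 i)].
  apply/seteqP; split=> [_ [x xv <-] i|w wA] /=.
    by rewrite mxE /A /= in_itv /=; exact: xv.
  exists [tuple w ord0 i | i < n]; last first.
    by apply/rowP => i; rewrite mxE tnth_mktuple.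
  by move=> i; rewrite tnth_mktuple; have := wA i; rewrite /A /= in_itv.
by apply: rV_compact => i; exact: segment_compact.
Qed.

End cubes.

(** * Averages over cubes and maximal functions *)

Section means.
Context {R : realType} {n : nat}.
Local Notation Rn := (Rn R n).
Local Notation mu := (@leb R n).
Local Notation node := (Rn * R)%type.
Implicit Types (v u P S : node) (x : Rn) (f h w : Rn -> R).

Definition cube_integrable f := forall v, 0 < v.2 -> mu.-integrable (ncube v) (EFin \o f).

Lemma loc_integrable_cube_integrable f : loc_integrable f -> cube_integrable f.
Proof.
move=> [mf If] v v0; apply/integrableP; split.
  by apply/measurable_EFinP; exact: measurable_funS mf.
exact: (If _ (@compact_ncube R n v)).
Qed.

Lemma integrable_cst_ncube (c : R) v : 0 < v.2 ->
  mu.-integrable (ncube v) (EFin \o (cst c : Rn -> R)).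
Proof.
move=> v0; apply/integrableP; split; first exact/measurable_EFinP.
have h : (\int[mu]_(x in ncube v) `|c|%:E = `|c|%:E * @leb R n (ncube v))%E.
  exact: (integral_cst mu (measurable_ncube v0)).
by rewrite leb_ncube// -EFinM in h; rewrite (le_lt_trans _ (ltry (`|c| * v.2 ^+ n)))// -h.
Qed.

Lemma cube_integrable_normB f c : cube_integrable f -> cube_integrable (fun x => `|f x - c|).
Proof.
move=> If v v0; have mv := measurable_ncube v0.
have -> : (EFin \o fun x => `|f x - c|) = (abse \o ((EFin \o f) \- (EFin \o (cst c : Rn -> R))))%E.
  by apply/funext.
apply: integrable_abse; apply: integrableB => //; first exact: If.
exact: integrable_cst_ncube.
Qed.

Lemma cube_integrable_norm f : cube_integrable f -> cube_integrable (fun x => `|f x|).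
Proof.
by move=> If v v0; exact: integrable_norm (If v v0).
Qed.

Definition vol v : R := v.2 ^+ n.
Definition mass h v : R := \int[mu]_(x in ncube v) h x.
Definition mean h v : R := mass h v / vol v.
Definition dev f c := fun x : Rn => `|f x - c|.

Lemma vol_gt0 v : 0 < v.2 -> 0 < vol v.
Proof. exact: exprn_gt0. Qed.

Lemma mass_ge0 h v : (forall x, 0 <= h x) -> 0 <= mass h v.
Proof. by move=> h0; apply: Rintegral_ge0. Qed.

Lemma massE h v : cube_integrable h -> 0 < v.2 ->
  (\int[mu]_(x in ncube v) (h x)%:E)%E = (mass h v)%:E.
Proof.
by move=> Ih v0; rewrite fineK//; apply: integrable_fin_num; [exact: measurable_ncube|exact: Ih].
Qed.

Lemma mass1 v : 0 < v.2 -> mass (cst 1 : Rn -> R) v = vol v.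
Proof.
move=> v0; have h : (\int[mu]_(x in ncube v) (1%:E) = 1%:E * @leb R n (ncube v))%E.
  exact: (integral_cst mu (measurable_ncube v0)).
by rewrite /mass /Rintegral /= h leb_ncube// mul1e.
Qed.

Lemma mass_le_sub h u v : cube_integrable h -> (forall x, 0 <= h x) -> 0 < u.2 -> 0 < v.2 ->
  ncube u `<=` ncube v -> mass h u <= mass h v.
Proof.
move=> Ih h0 u0 v0 uv; rewrite -lee_fin -!massE//.
by apply: le_integral_subset => // x _; rewrite lee_fin.
Qed.

(** The ratio of the volumes is at most k ^+ n. *)
Lemma mean_le_sub (k : R) h u v : cube_integrable h -> (forall x, 0 <= h x) -> 0 < u.2 -> 0 < v.2 ->
  ncube u `<=` ncube v -> v.2 <= k * u.2 -> mean h u <= k ^+ n * mean h v.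
Proof.
move=> Ih h0 u0 v0 uv vu; rewrite /mean mulrCA.
have m := mass_le_sub Ih h0 u0 v0 uv.
apply: (@le_trans _ _ (mass h v / vol u)).
  by rewrite ler_wpM2r// invr_ge0 ltW// vol_gt0.
rewrite ler_wpM2l ?mass_ge0//.
rewrite ler_pdivlMr ?vol_gt0// mulrC ler_pdivrMr ?vol_gt0//.
by rewrite -exprMn lerXn2r// nnegrE ltW// (lt_le_trans v0).
Qed.

Lemma mass_child_le h v : cube_integrable h -> (forall x, 0 <= h x) -> 0 < v.2 ->
  \sum_(e : {ffun 'I_n -> bool}) mass h (dyadic_child v e) <= mass h v.
Proof.
move=> Ih h0 v0; have c0 e := dyadic_child_side_gt0 e v0.
have mh : measurable_fun (ncube v) (EFin \o h) := measurable_int _ (Ih v v0).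
pose g e := (EFin \o h) \_ (ncube (dyadic_child v e)).
have g0 e x : (0 <= g e x)%E.
  by rewrite /g /patch; case: ifP => _ //; rewrite lee_fin.
have mg e : measurable_fun (ncube v) (g e).
  apply: (measurable_restrict (EFin \o h) (measurable_ncube (c0 e)) (measurable_ncube v0)).1.
  by apply: measurable_funS mh => //; exact: measurable_ncube.
have me e : (\int[mu]_(x in ncube (dyadic_child v e)) (h x)%:E =
    \int[mu]_(x in ncube v) g e x)%E.
  by rewrite -integral_mkcondr (setIidr (ncube_dyadic_child_sub v0)).
rewrite -lee_fin -sumEFin -massE//; under eq_bigr do rewrite -massE// me.
rewrite -ge0_integral_sum//; last exact: measurable_ncube.
apply: (@ae_ge0_le_integral _ _ _ mu (ncube v) (measurable_ncube v0)).
- by move=> x _; apply: sume_ge0.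
- exact: emeasurable_sum.
- by move=> x _; rewrite lee_fin.
- exact: mh.
- apply: filterS (dyadic_child_ae_disjoint v0) => x xe xv.
  have [e /= ex] := ncube_dyadic_child_cover xv.
  rewrite (bigD1 e)//= big1 ?adde0; last first.
    move=> e' /eqP e'e; rewrite /g patchN// notin_setE => e'x.
    exact/e'e/xe.
  by rewrite /g patchT// inE.
Qed.

Lemma mean_sub_le f c v : cube_integrable f -> 0 < v.2 ->
  `|mean f v - c| <= mean (dev f c) v.
Proof.
move=> If v0; have mv := measurable_ncube v0.
have Ic := integrable_cst_ncube c v0.
have -> : mean f v - c = (\int[mu]_(x in ncube v) (f x - c)) / vol v.
  rewrite RintegralB//; last exact: If.
  rewrite Rintegral_cst// (_ : fine _ = vol v); last first.
    by rewrite -[RHS]/(fine (vol v)%:E) -(leb_ncube v0).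
  rewrite mulrBl mulfK//.
  by rewrite gt_eqF// vol_gt0.
have V0 : 0 <= (vol v)^-1 by rewrite invr_ge0 ltW// vol_gt0.
rewrite normrM (ger0_norm V0) /mean ler_wpM2r//.
apply: le_normr_Rintegral => //.
have -> : (EFin \o fun x => f x - c) = ((EFin \o f) \- (EFin \o (cst c : Rn -> R)))%E.
  by apply/funext.
by apply: integrableB => //; exact: If.
Qed.

Lemma inve_leb_ncube v : 0 < v.2 -> ((mu (ncube v))^-1 = ((vol v)^-1)%:E)%E.
Proof. by move=> v0; rewrite leb_ncube// inver gt_eqF// vol_gt0. Qed.

Lemma mean_mulE h v : cube_integrable h -> 0 < v.2 ->
  ((mu (ncube v))^-1 * \int[mu]_(x in ncube v) (h x)%:E = (mean h v)%:E)%E.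
Proof. by move=> Ih v0; rewrite inve_leb_ncube// massE// -EFinM mulrC. Qed.

Lemma avgE f v : cube_integrable f -> 0 < v.2 -> avg f (ncube v) = (mean f v)%:E.
Proof. exact: mean_mulE. Qed.

Lemma maximal_ge f v x : cube_integrable f -> 0 < v.2 -> ncube v x ->
  ((mean (fun y => `|f y|) v)%:E <= maximal f x)%E.
Proof.
move=> If v0 xv; apply: ereal_sup_ubound; exists (ncube v) => /=.
  by split => //; exact: is_cube_ncube.
by rewrite -mean_mulE//; exact: cube_integrable_norm.
Qed.

Lemma maximal_le f x B : cube_integrable f ->
  (forall v, 0 < v.2 -> ncube v x -> ((mean (fun y => `|f y|) v)%:E <= B)%E) ->
  (maximal f x <= B)%E.
Proof.
move=> If fB; apply: ge_ereal_sup => _ [Q [/is_cubeP[v v0 ->] xv] <-].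
by rewrite (mean_mulE (cube_integrable_norm If) v0) fB.
Qed.

Lemma sharp_maximal_ge f v x : cube_integrable f -> 0 < v.2 -> ncube v x ->
  ((mean (dev f (mean f v)) v)%:E <= sharp_maximal f x)%E.
Proof.
move=> If v0 xv; apply: ereal_sup_ubound; exists (ncube v) => /=.
  by split => //; exact: is_cube_ncube.
rewrite -mean_mulE//; last exact: cube_integrable_normB.
by rewrite avgE.
Qed.

End means.

(** * Integrating sums over dyadic branches *)

Section leaf_sum_integral.
Context {R : realType} {n : nat}.
Local Notation Rn := (Rn R n).
Local Notation mu := (@leb R n).
Local Notation node := (Rn * R)%type.
Implicit Types (v u P S Q : node) (x : Rn) (h : Rn -> R).
Variables (stop : node -> node -> bool) (z : R) (c : node -> R).
Hypotheses (z0 : 0 <= z) (c0 : forall S, 0 <= c S).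

(** The sum over the branches of the dyadic tree that pass through x of c at the
    last stopping cube, times z to the number of stops. *)
Definition leaf_fun (K : nat) v S x : R :=
  leaf_sum dyadic_child stop z (fun u T => c T * \1_(ncube u) x) K v S.

Lemma leaf_fun_ge0 K v S x : 0 <= leaf_fun K v S x.
Proof. by apply: leaf_sum_ge0 => // u T; rewrite mulr_ge0. Qed.

Lemma measurable_leaf_fun K v S : 0 < v.2 ->
  measurable_fun [set: Rn] (leaf_fun K v S).
Proof.
rewrite /leaf_fun; elim: K v S => [|K IH] v S v0 /=.
  apply: measurable_funM; first exact: measurable_cst.
  by apply: measurable_indic; exact: measurable_ncube.
apply: measurable_sum => e; have e0 := dyadic_child_side_gt0 e v0.
case: (stop (dyadic_child v e) S); last exact: IH.
apply: measurable_funM; [exact: measurable_cst|exact: IH].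
Qed.

Lemma integral_leaf_fun h Q K v S : cube_integrable h -> (forall x, 0 <= h x) ->
  0 < Q.2 -> 0 < v.2 -> ncube v `<=` ncube Q ->
  (\int[mu]_(x in ncube Q) (leaf_fun K v S x * h x)%:E =
   (leaf_sum dyadic_child stop z (fun u T => c T * mass h u) K v S)%:E)%E.
Proof.
move=> Ih h0 Q0; have mQ := measurable_ncube Q0.
have mh : measurable_fun (ncube Q) h.
  by apply/measurable_EFinP; exact: measurable_int (Ih Q Q0).
have mlh K' u T : 0 < u.2 ->
    measurable_fun (ncube Q) (fun x => (leaf_fun K' u T x * h x)%:E).
  move=> u0; apply/measurable_EFinP; apply: measurable_funM => //.
  by apply: measurable_funS (measurable_leaf_fun K' T u0).
elim: K v S => [|K IH] v S v0 vQ.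
  rewrite /leaf_fun /=.
  under eq_integral do rewrite -mulrA EFinM.
  rewrite (@ge0_integralZl _ _ _ mu _ mQ); last 3 first.
  - apply/measurable_EFinP; apply: measurable_funM => //.
    by apply: measurable_indic; exact: measurable_ncube.
  - by move=> x _; rewrite lee_fin mulr_ge0.
  - by rewrite lee_fin.
  rewrite EFinM -massE//; congr (_ * _)%E.
  rewrite -[in RHS](setIidr vQ) integral_mkcondr; apply: eq_integral => x _.
  rewrite /patch indicE; case: ifP => _; rewrite ?mul1r ?mul0r//.
have e0 e := dyadic_child_side_gt0 e v0.
have eQ e : ncube (dyadic_child v e) `<=` ncube Q.
  by apply: subset_trans vQ; exact: ncube_dyadic_child_sub.
transitivity (\int[mu]_(x in ncube Q) (\sum_(e : {ffun 'I_n -> bool})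
  (let u := dyadic_child v e in
   if stop u S then z%:E * (leaf_fun K u u x * h x)%:E
   else (leaf_fun K u S x * h x)%:E)))%E.
  apply: eq_integral => x _; rewrite {1}/leaf_fun /= mulr_suml -sumEFin.
  by apply: eq_bigr => e _; case: ifP => _//; rewrite -mulrA EFinM.
rewrite (@ge0_integral_sum _ _ _ mu _ mQ); last 2 first.
- move=> e /=; case: (stop (dyadic_child v e) S); last exact: mlh.
  by apply: measurable_funeM; exact: mlh.
- move=> e x _ /=; case: ifP => _; rewrite ?mule_ge0// lee_fin ?mulr_ge0//;
  exact: leaf_fun_ge0.
rewrite /= -sumEFin; apply: eq_bigr => e _.
case: (stop (dyadic_child v e) S); last exact: IH.
rewrite (@ge0_integralZl _ _ _ mu _ mQ); last 3 first.
- exact: mlh.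
- by move=> x _; rewrite lee_fin mulr_ge0//; exact: leaf_fun_ge0.
- by rewrite lee_fin.
by rewrite IH.
Qed.

(** Almost every x lies on a single branch, so that for z = 1 the sum is c T for
    the last stopping cube T containing x. *)
Lemma leaf_fun_ae_le (M : Rn -> \bar R) Q K v S : z = 1 -> 0 < v.2 -> 0 < S.2 ->
  (forall T x, 0 < T.2 -> ncube T `<=` ncube Q -> ncube T x -> ((c T)%:E <= M x)%E) ->
  ncube v `<=` ncube S -> ncube S `<=` ncube Q ->
  {ae mu, forall x, (ncube v x -> ((leaf_fun K v S x)%:E <= M x)%E) /\
    (~ ncube v x -> leaf_fun K v S x = 0)}.
Proof.
move=> z1 + + cM; elim: K v S => [|K IH] v S v0 S0 vS SQ.
  apply: aeW => x; split=> xv; rewrite /leaf_fun /= indicE.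
    by rewrite mem_set// mulr1; apply: cM => //; exact: vS.
  by rewrite memNset// mulr0.
have e0 e := dyadic_child_side_gt0 e v0.
have ev e : ncube (dyadic_child v e) `<=` ncube v by exact: ncube_dyadic_child_sub.
have eS e := subset_trans (ev e) vS.
have /filter_forall H1 := fun e => IH (dyadic_child v e) S (e0 e) S0 (eS e) SQ.
have /filter_forall H2 := fun e => IH (dyadic_child v e) (dyadic_child v e)
  (e0 e) (e0 e) (@subset_refl _ _) (subset_trans (eS e) SQ).
have H3 := dyadic_child_ae_disjoint v0.
have H : {ae mu, forall x, [/\ forall e : {ffun 'I_n -> bool},
   let t := leaf_fun K (dyadic_child v e) S x in
    (ncube (dyadic_child v e) x -> (t%:E <= M x)%E) /\ (~ ncube (dyadic_child v e) x -> t = 0),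
   forall e : {ffun 'I_n -> bool},
   let t := leaf_fun K (dyadic_child v e) (dyadic_child v e) x in
    (ncube (dyadic_child v e) x -> (t%:E <= M x)%E) /\ (~ ncube (dyadic_child v e) x -> t = 0) &
   forall e e' : {ffun 'I_n -> bool},
     ncube (dyadic_child v e) x -> ncube (dyadic_child v e') x -> e = e']}.
  by move: H1 H2 H3; apply: filterS3 => x; split.
apply: filterS H => x [h1 h2 h3].
have E : leaf_fun K.+1 v S x = \sum_(e : {ffun 'I_n -> bool})
   (let u := dyadic_child v e in
    if stop u S then leaf_fun K u u x else leaf_fun K u S x).
  by rewrite {1}/leaf_fun z1/=; apply: eq_bigr => e _; rewrite mul1r -z1.
have E0 e : ~ ncube (dyadic_child v e) x ->
  (let u := dyadic_child v e in
    if stop u S then leaf_fun K u u x else leaf_fun K u S x) = 0.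
  by move=> xe /=; case: ifP => _; [exact: (h2 e).2 | exact: (h1 e).2].
split=> xv; rewrite E; last by apply: big1 => e _; apply: E0 => /ev.
have [e xe] := ncube_dyadic_child_cover xv.
rewrite (bigD1 e)//= big1 ?addr0; first last.
  by move=> e' /eqP e'e; apply: E0 => xe'; exact/e'e/h3.
by case: ifP => _; [exact: (h2 e).1 | exact: (h1 e).1].
Qed.

End leaf_sum_integral.

(** * Weights and the Fujii-Wilson constant *)

Section weights.
Context {R : realType} {n : nat}.
Local Notation Rn := (Rn R n).
Local Notation mu := (@leb R n).
Local Notation node := (Rn * R)%type.
Implicit Types (v u S Q : node) (x : Rn) (f w : Rn -> R).

Definition absf w := fun x : Rn => `|w x|.

Lemma absf_ge0 w x : 0 <= absf w x.
Proof. exact: normr_ge0. Qed.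

Lemma wmeas_ncube w v : weight w -> 0 < v.2 -> wmeas w (ncube v) = (mass (absf w) v)%:E.
Proof.
move=> [/loc_integrable_cube_integrable Iw w0] v0; rewrite -massE//; last exact: cube_integrable_norm.
apply: ae_eq_integral.
- exact: measurable_ncube.
- exact: measurable_int (Iw v v0).
- exact: measurable_int (cube_integrable_norm Iw v0).
- by apply: filterS w0 => x w0 _; rewrite /absf gtr0_norm.
Qed.

Lemma mass_weight_gt0 w v : weight w -> 0 < v.2 -> 0 < mass (absf w) v.
Proof.
move=> ww v0; rewrite lt_def mass_ge0 ?andbT; last exact: absf_ge0.
case: ww => /loc_integrable_cube_integrable Iw w0; apply/negP => /eqP m0.
have mw : measurable_fun (ncube v) (EFin \o w) := measurable_int _ (Iw v v0).
have : (\int[mu]_(x in ncube v) `|(EFin \o w) x| = 0)%E.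
  by rewrite -[RHS]/(0%:E) -m0 -massE//; exact: cube_integrable_norm.
move=> /(ae_eq_integral_abs mu (measurable_ncube v0) mw) h0.
have [N [mN N0 vN]] : {ae mu, forall x, ~ ncube v x}.
  by apply: filterS2 w0 h0 => x w0 h0 /h0 /= [wx]; rewrite wx ltxx in w0.
have : mu (ncube v) = 0%E.
  apply: (subset_measure0 (measurable_ncube v0) mN _ N0) => x xv.
  by apply: vN => /= /(_ xv).
by rewrite leb_ncube// => -[/eqP]; rewrite gt_eqF// exprn_gt0.
Qed.

(** Inside S the truncation of w to S is invisible. *)
Lemma maximal_indic_ge w S u x : cube_integrable w -> 0 < u.2 -> ncube u `<=` ncube S -> ncube u x ->
  ((mean (absf w) u)%:E <= maximal (fun y => w y * \1_(ncube S) y)%R x)%E.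
Proof.
move=> Iw u0 uS xu; apply: ereal_sup_ubound; exists (ncube u) => /=.
  by split => //; exact: is_cube_ncube.
rewrite -mean_mulE//; last exact: cube_integrable_norm.
congr (_ * _)%E; apply: eq_integral => y /set_mem yu.
by rewrite indicE mem_set ?mulr1//; exact: uS.
Qed.

Lemma maximal_ge0 f x : (0 <= maximal f x)%E.
Proof.
pose v : node := ([tuple (tnth x i : R) | i < n], 1).
have xv : ncube v x by apply/ncubeP => i; rewrite /= tnth_mktuple; lra.
have v0 : 0 < v.2 by rewrite /=.
apply: (@le_trans _ _ ((mu (ncube v))^-1 * \int[mu]_(y in ncube v) `|f y|%:E)%E).
  rewrite mule_ge0// ?inve_ge0 ?measure_ge0//.
  by apply: integral_ge0 => y _; rewrite lee_fin.
apply: ereal_sup_ubound; exists (ncube v) => //=.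
by split => //; exact: is_cube_ncube.
Qed.

Lemma integral_maximal_le w S : weight w -> Ainfty w -> 0 < S.2 ->
  (\int[mu]_(x in ncube S) maximal (fun y => w y * \1_(ncube S) y)%R x
    <= (fine (Ainfty_const w) * mass (absf w) S)%:E)%E.
Proof.
move=> ww Aw S0; have W0 := mass_weight_gt0 ww S0.
set I := (\int[mu]_(x in _) _)%E.
have IA : (((mass (absf w) S)^-1)%:E * I <= Ainfty_const w)%E.
  apply: ereal_sup_ubound; exists (ncube S); first exact: is_cube_ncube.
  by rewrite wmeas_ncube// inver gt_eqF.
have Af : Ainfty_const w \is a fin_num.
  rewrite ge0_fin_numE//; apply: le_trans IA; rewrite mule_ge0//.
    by rewrite lee_fin invr_ge0 ltW.
  by apply: integral_ge0 => x _; exact: maximal_ge0.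
rewrite EFinM fineK// muleC -lee_pdivrMl//.
Qed.

End weights.

(** * The packing condition for stopping cubes *)

Section stopping_cubes.
Context {R : realType} {n : nat}.
Local Notation Rn := (Rn R n).
Local Notation mu := (@leb R n).
Local Notation node := (Rn * R)%type.
Implicit Types (v u S Q : node) (x : Rn).
Variable f : Rn -> R.
Hypothesis If : cube_integrable f.

Definition fdev S : Rn -> R := dev f (mean f S).
Definition osc S : R := mean (fdev S) S.

(** When osc f S vanishes no cube inside S satisfies the second inequality; the
    first one extends this to all cubes u, so that dividing by osc f S is
    harmless. *)
Definition stopping u S : bool :=
  (0 < osc S) && (2 * osc S * vol u < mass (fdev S) u).

Let ok v := 0 < v.2.

Lemma cube_integrable_fdev S : cube_integrable (fdev S).
Proof. exact: cube_integrable_normB. Qed.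

Lemma fdev_ge0 S x : 0 <= fdev S x.
Proof. exact: normr_ge0. Qed.

Lemma osc_ge0 S : ok S -> 0 <= osc S.
Proof.
by move=> S0; rewrite divr_ge0 ?mass_ge0//; [exact: fdev_ge0|exact/ltW/vol_gt0].
Qed.

Lemma mean_fdev_not_stopping u S : ok u -> ok S -> ncube u `<=` ncube S ->
  ~~ stopping u S -> mean (fdev S) u <= 2 * osc S.
Proof.
move=> u0 S0 uS; rewrite negb_and => /orP[|]; rewrite -leNgt => h.
  have o0 : osc S = 0 by apply/eqP; rewrite eq_le h osc_ge0.
  have m0 : mass (fdev S) S = 0.
    by move/eqP: o0; rewrite mulf_eq0 invr_eq0 (gt_eqF (vol_gt0 S0)) orbF => /eqP.
  have := mass_le_sub (cube_integrable_fdev S) (@fdev_ge0 S) u0 S0 uS.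
  rewrite m0 o0 mulr0 => mu0; rewrite /mean mulr_le0_ge0//.
  by rewrite invr_ge0 ltW// vol_gt0.
by rewrite ler_pdivrMr// vol_gt0.
Qed.

Variable w : Rn -> R.
Hypotheses (ww : weight w) (Aw : Ainfty w).
Let D := fine (Ainfty_const w).
Let W := mass (absf w).
Let Iw : cube_integrable w. Proof. by case: ww => /loc_integrable_cube_integrable. Qed.
Let Iaw : cube_integrable (absf w). Proof. exact: cube_integrable_norm. Qed.

(** The left-hand side is the integral over S of the average of w over the last
    stopping cube containing x, a function dominated by M(w 1_S). *)
Lemma leaf_sum_mean_le K S : ok S ->
  leaf_sum dyadic_child stopping 1 (fun u T => mean (absf w) T * vol u) K S S
  <= D * W S.
Proof.
move=> S0; have mS := measurable_ncube S0.
(* the absolute value makes c nonnegative at pairs with a negative side too *)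
pose c T : R := `|mean (absf w) T|.
have cE T : ok T -> c T = mean (absf w) T.
  move=> T0; rewrite /c ger0_norm// divr_ge0//; last exact/ltW/vol_gt0.
  by apply: mass_ge0; exact: absf_ge0.
have I1 : cube_integrable (cst 1 : Rn -> R) by move=> v v0; exact: integrable_cst_ncube.
rewrite -lee_fin.
rewrite (@eq_leaf_sum _ _ _ _ _ ok dyadic_child_side_gt0 1 _
  (fun u T => c T * mass (cst 1) u))//; last first.
  by move=> u T u0 T0; rewrite cE// mass1.
have c0 T : 0 <= c T by exact: normr_ge0.
have u0 x : 0 <= (cst 1 : Rn -> R) x by exact: ler01.
rewrite -(integral_leaf_fun stopping ler01 c0 K S I1 u0 S0 S0 (@subset_refl _ _)).
under eq_integral do rewrite mulr1.
apply: le_trans (integral_maximal_le ww Aw S0).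
apply: (@ae_le_integral_lower _ _ _ mu _ _ _ mS).
- apply/measurable_EFinP.
  by apply: measurable_funS (measurable_leaf_fun stopping 1 c K S S0).
- by move=> x _; rewrite lee_fin; apply: leaf_fun_ge0.
- by move=> x _; exact: maximal_ge0.
- have := @leaf_fun_ae_le R n stopping 1 c
    (maximal (fun y => w y * \1_(ncube S) y)) S K S S erefl S0 S0.
  move=> h; have {}h := h _ (@subset_refl _ _) (@subset_refl _ _).
  apply: filterS (h _) => [x [h1 _]//|T x T0 TS xT].
  by rewrite cE//; exact: maximal_indic_ge.
Qed.

(** The Carleson packing condition; the term W S on the left accounts for S
    itself. *)
Lemma stop_sum_le K S : ok S ->
  stop_sum dyadic_child stopping W K S S + W S <= 2 * (D * W S).
Proof.
move=> S0; apply: (@le_trans _ _ (2 * leaf_sum dyadic_child stopping 1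
   (fun u T => mean (absf w) T * vol u) K S S)); last first.
  by rewrite ler_wpM2l// leaf_sum_mean_le.
apply: (@stop_sum_le_leaf_sum _ _ _ dyadic_child stopping ok
  dyadic_child_side_gt0 W vol (fun u T => mass (fdev T) u / `|osc T|)) => //.
- by move=> v; apply: mass_ge0; exact: absf_ge0.
- exact: vol_gt0.
- by move=> v _; exact: sum_dyadic_child_side.
- by move=> v T; rewrite divr_ge0// mass_ge0//; exact: fdev_ge0.
- move=> v T v0; rewrite -mulr_suml ler_wpM2r ?invr_ge0//.
  by apply: mass_child_le => //; [exact: cube_integrable_fdev|exact: fdev_ge0].
- move=> T T0; rewrite ger0_norm ?osc_ge0// /osc /mean invf_div mulrCA.
  have [->|m0] := eqVneq (mass (fdev T) T) 0.
    by rewrite mul0r mulr0 ltW// vol_gt0.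
  by rewrite divff// mulr1.
- move=> v T v0 /andP[p0 h]; rewrite gtr0_norm// ler_pdivlMr//.
  by apply/ltW; rewrite mulrAC.
Qed.

End stopping_cubes.

(** * Exponential integrability of the number of stops *)

Section exponential_function.
Context {R : realType} {n : nat}.
Local Notation Rn := (Rn R n).
Local Notation mu := (@leb R n).
Local Notation node := (Rn * R)%type.
Implicit Types (v u S Q : node) (x : Rn).
Variables f w : Rn -> R.
Hypotheses (If : cube_integrable f) (ww : weight w) (Aw : Ainfty w).
Let ok v := 0 < v.2.
Let D := fine (Ainfty_const w).
Let W := mass (absf w).
Let Iaw : cube_integrable (absf w).
Proof. by case: ww => /loc_integrable_cube_integrable Iw _; exact: cube_integrable_norm. Qed.

(** The packing condition at depth 0 reads W S <= 2 [w] W S. *)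
Lemma Ainfty_const_ge : 1 / 2 <= D.
Proof.
pose S : node := ([tuple 0 | i < n], 1).
have S0 : ok S by rewrite /ok /=.
have := stop_sum_le If ww Aw 0 S0; rewrite /= add0r mulrA.
have W0 : 0 < W S by exact: mass_weight_gt0.
by rewrite -[leLHS]mul1r ler_pM2r// -/D; lra.
Qed.

(** Close enough to 1 for the packing constant 2 [w]: the factor 8 leaves room
    for the final bound 2 W S of leaf_mass_le. *)
Definition growth_base : R := 1 + (8 * D)^-1.
Local Notation z := growth_base.

Lemma growth_base_gt1 : 1 < growth_base.
Proof. by have := Ainfty_const_ge => h; rewrite ltrDl invr_gt0; lra. Qed.

Lemma leaf_mass_le K S : ok S ->
  z * leaf_sum dyadic_child (stopping f) z (fun u _ => W u) K S S <= 2 * W S.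
Proof.
move=> S0; have D2 := Ainfty_const_ge; have W0 : 0 < W S by exact: mass_weight_gt0.
have zD : (z - 1) * D = 1 / 8.
  by rewrite /growth_base addrAC subrr add0r; field; lra.
have z1 := growth_base_gt1.
have HD K' T : ok T -> stop_sum dyadic_child (stopping f) W K' T T <= 2 * D * W T.
  move=> T0; have := stop_sum_le If ww Aw K' T0; rewrite -/D -/W.
  by have : 0 <= W T by [apply: mass_ge0; exact: absf_ge0]; lra.
have := @leaf_sum_le_stop_sum _ _ _ dyadic_child (stopping f) ok
  dyadic_child_side_gt0 W _ _ z D K S S (ltW z1) S0 S0 _ HD.
move=> h; have {h} := h _ _ _.
have {HD} := HD K S S0; set A := stop_sum _ _ _ _ _ _; set L := leaf_sum _ _ _ _ _ _ _.
move=> AW h.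
have {}h : L <= W S + 2 * (z - 1) * A.
  apply: h.
  - by move=> v; apply: mass_ge0; exact: absf_ge0.
  - by move=> v v0; apply: mass_child_le => //; exact: absf_ge0.
  - lra.
have {}h : L <= 3 / 2 * W S.
  apply: (le_trans h).
  have : (z - 1) * A <= (z - 1) * (2 * D * W S) by rewrite ler_wpM2l//; lra.
  have -> : (z - 1) * (2 * D * W S) = ((z - 1) * D) * 2 * W S by ring.
  by rewrite zD; lra.
have z54 : z <= 5 / 4.
  rewrite /growth_base; have : (8 * D)^-1 <= 1 / 4; last lra.
  by rewrite -[1 / 4]invrK lef_pV2 ?posrE; lra.
have : z * L <= z * (3 / 2 * W S) by rewrite ler_wpM2l//; lra.
have : z * (3 / 2 * W S) <= 5 / 4 * (3 / 2 * W S) by rewrite ler_wpM2r//; lra.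
lra.
Qed.

(** Up to null sets, z to the number of stopping cubes that contain x within K
    generations of Q. *)
Definition stop_power K Q x : R := leaf_fun (stopping f) z (fun=> 1) K Q Q x.

Lemma stop_power_ge0 K Q x : 0 <= stop_power K Q x.
Proof. by apply: leaf_fun_ge0 => //; have := growth_base_gt1; lra. Qed.

Lemma stop_power_leS K Q x : stop_power K Q x <= stop_power K.+1 Q x.
Proof.
apply: leaf_sum_leS; first exact/ltW/growth_base_gt1.
- by move=> u T; rewrite mul1r.
move=> u T; rewrite mul1r.
have [xu|xu] := pselect (ncube u x).
  have [e xe] := ncube_dyadic_child_cover xu.
  by exists e; rewrite mul1r !indicE !mem_set.
by exists [ffun=> false]; rewrite mul1r [leLHS]indicE memNset.
Qed.

Lemma stop_power_bound Q : ok Q -> exists H : Rn -> \bar R,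
  [/\ measurable_fun [set: Rn] H, (forall x, 0 <= H x)%E,
      (forall K x, ((z * stop_power K Q x)%:E <= H x)%E) &
      (\int[mu]_(x in ncube Q) (H x * (absf w x)%:E) <= (2 * W Q)%:E)%E].
Proof.
move=> Q0; pose g K x := (z * stop_power K Q x)%:E.
have z0 : 0 <= z by have := growth_base_gt1; lra.
have nd x : nondecreasing_seq (g ^~ x).
  apply/nondecreasing_seqP => K; rewrite lee_fin ler_wpM2l//.
  exact: stop_power_leS.
have cvg x : g ^~ x @ \oo --> ereal_sup (range (g ^~ x)).
  exact: ereal_nondecreasing_cvgn.
pose H x := ereal_sup (range (g ^~ x)).
have mg K : measurable_fun [set: Rn] (g K).
  apply/measurable_EFinP; apply: measurable_funM; first exact: measurable_cst.
  exact: measurable_leaf_fun.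
have gH K x : (g K x <= H x)%E by apply: ereal_sup_ubound; exists K.
exists H; split; [| |exact: gH|].
- by apply: (@emeasurable_fun_cvg _ _ _ setT g H mg) => x _; exact: cvg.
- move=> x; apply: le_trans (gH 0 x); rewrite lee_fin mulr_ge0//.
  exact: stop_power_ge0.
have mQ := measurable_ncube Q0.
have maw : measurable_fun (ncube Q) (EFin \o absf w) := measurable_int _ (Iaw Q0).
have -> : (\int[mu]_(x in ncube Q) (H x * (absf w x)%:E) =
  \int[mu]_(x in ncube Q) limn (fun K => g K x * (absf w x)%:E))%E.
  by apply: eq_integral => x _; apply/esym/cvg_lim => //; exact: cvgeZr.
rewrite (@monotone_convergence _ _ _ mu _ mQ); last 3 first.
- move=> K; apply: emeasurable_funM => //.
  by apply: measurable_funS (mg K).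
- move=> K x _; rewrite mule_ge0// lee_fin ?absf_ge0// mulr_ge0//.
  exact: stop_power_ge0.
- move=> x _ i j ij; apply: lee_wpmul2r; first by rewrite lee_fin absf_ge0.
  exact: nd.
have E K : (\int[mu]_(x in ncube Q) (g K x * (absf w x)%:E) =
  (z * leaf_sum dyadic_child (stopping f) z (fun u _ => W u) K Q Q)%:E)%E.
  transitivity (\int[mu]_(x in ncube Q) (z%:E * (stop_power K Q x * absf w x)%:E))%E.
    by apply: eq_integral => x _; rewrite /g EFinM -muleA -EFinM.
  rewrite (@ge0_integralZl _ _ _ mu _ mQ); last 3 first.
  - apply/measurable_EFinP; apply: measurable_funM; last exact/measurable_EFinP.
    by apply: measurable_funS (measurable_leaf_fun (stopping f) z (fun=> 1) K Q Q0).
  - by move=> x _; rewrite lee_fin mulr_ge0 ?absf_ge0//; exact: stop_power_ge0.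
  - by rewrite lee_fin.
  rewrite (integral_leaf_fun (stopping f) z0 (fun=> ler01) K Q Iaw (@absf_ge0 _ _ w)
    Q0 Q0 (@subset_refl _ _)).
  rewrite EFinM; congr (_ * _%:E)%E.
  by apply: (@eq_leaf_sum _ _ _ _ _ ok dyadic_child_side_gt0) => // u T _ _; rewrite mul1r.
apply: lime_le.
  apply: ereal_nondecreasing_is_cvgn; apply/nondecreasing_seqP => K.
  apply: le_integral_subset => // x _.
    by apply: lee_wpmul2r; [rewrite lee_fin absf_ge0|exact: (nd x K K.+1)].
  rewrite mule_ge0// lee_fin ?absf_ge0// mulr_ge0//.
  exact: stop_power_ge0.
by apply: nearW => K; rewrite E lee_fin leaf_mass_le.
Qed.

End exponential_function.

(** * Pointwise control by the number of stops *)

Section pointwise.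
Context {R : realType} {n : nat}.
Local Notation Rn := (Rn R n).
Local Notation node := (Rn * R)%type.
Implicit Types (v u S Q P U : node) (x : Rn).
Variables f : Rn -> R.
Hypotheses (If : cube_integrable f).

(** Following x down the dyadic tree, the average of f moves by at most 2 M as
    long as no cube stops; a cube e' that stops has a parent that did not, so
    there the average moves by at most 2 ^+ n times 2 M, and the count c goes up
    by one. *)
Lemma leaf_path (z M : R) x K v S : 1 <= z ->
  (forall T, 0 < T.2 -> ncube T x -> osc f T <= M) ->
  0 < v.2 -> 0 < S.2 -> ncube v x -> ncube v `<=` ncube S ->
  mean (fdev f S) v <= 2 * osc f S ->
  exists u c, [/\ [/\ 0 < u.2, u.2 = v.2 / 2 ^+ K & ncube u x],
    z ^+ c <= leaf_fun (stopping f) z (fun=> 1) K v S x &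
    `|mean f u - mean f S| <= 2 ^+ n.+1 * c.+1%:R * M].
Proof.
move=> z1 oscM; have z0 : 0 <= z by lra.
have M0 S' : 0 < S'.2 -> ncube S' x -> 0 <= M.
  by move=> S0 xS; apply: le_trans (oscM _ S0 xS); exact: osc_ge0.
have two (k : nat) : 2 <= 2 ^+ n.+1 * k.+1%:R :> R.
  rewrite exprS -mulrA ler_peMr// mulr_ege1 ?exprn_ege1 ?ler1n//; lra.
elim: K v S => [|K IH] v S v0 S0 xv vS vdev.
  have {}M0 := M0 _ v0 xv.
  exists v, 0%N; split; rewrite ?expr0 ?divr1//.
    by rewrite /leaf_fun /= mul1r indicE mem_set.
  apply: (le_trans (mean_sub_le _ If v0)); apply: (le_trans vdev).
  apply: (@le_trans _ _ (2 * M)); last by rewrite ler_wpM2r.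
  by rewrite ler_wpM2l// oscM//; exact: vS.
have {}M0 := M0 _ v0 xv.
have [e xe] := ncube_dyadic_child_cover xv; set e' := dyadic_child v e in xe.
have e0 : 0 < e'.2 by exact: dyadic_child_side_gt0.
have ev : ncube e' `<=` ncube v by exact: ncube_dyadic_child_sub.
have le_sum : (if stopping f e' S
    then z * leaf_fun (stopping f) z (fun=> 1) K e' e' x
    else leaf_fun (stopping f) z (fun=> 1) K e' S x)
    <= leaf_fun (stopping f) z (fun=> 1) K.+1 v S x.
  rewrite {3}/leaf_fun /= (bigD1 e)//= lerDl.
  apply: sumr_ge0 => e2 _.
  by case: ifP => _; rewrite ?mulr_ge0//; apply: leaf_fun_ge0.
have sideE : e'.2 / 2 ^+ K = v.2 / 2 ^+ K.+1.
  by rewrite /= -mulrA -invfM exprS.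
case: ifP le_sum => [se|/negbT se] le_sum.
  have [|u [c [[u0 uE xu] zc uc]]] := IH e' e' e0 e0 xe (@subset_refl _ _).
    by rewrite -[leLHS]/(osc f e'); have := osc_ge0 f e0; lra.
  exists u, c.+1; split; [by split=> //; rewrite uE sideE| |].
    by apply: le_trans le_sum; rewrite exprS ler_wpM2l.
  rewrite -(subrK (mean f e') (mean f u)) -addrA.
  apply: (le_trans (ler_normD _ _)).
  have -> : 2 ^+ n.+1 * c.+2%:R * M = 2 ^+ n.+1 * c.+1%:R * M + 2 ^+ n.+1 * M.
    by rewrite -(natr1 c.+1); ring.
  apply: lerD => //.
  apply: (le_trans (mean_sub_le _ If e0)).
  apply: (@le_trans _ _ (2 ^+ n * mean (fdev f S) v)).
    apply: mean_le_sub => //; [exact: cube_integrable_fdev|exact: fdev_ge0|].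
    by rewrite /= mulrC divfK.
  rewrite exprSr -mulrA ler_wpM2l ?exprn_ge0//.
  apply: (le_trans vdev); rewrite ler_wpM2l// oscM//; exact: vS.
have [|u [c [[u0 uE xu] zc uc]]] := IH e' S e0 S0 xe (subset_trans ev vS).
  apply: mean_fdev_not_stopping => //; exact: subset_trans ev vS.
by exists u, c; split; [split=> //; rewrite uE sideE|apply: le_trans le_sum|].
Qed.

Lemma mean_norm_le c P : 0 < P.2 ->
  mean (fun y => `|f y|) P <= mean (dev f c) P + `|c|.
Proof.
move=> P0; have h := mean_sub_le `|c| (cube_integrable_norm If) P0.
have : mean (dev (fun x => `|f x|) `|c|) P <= mean (dev f c) P.
  have V0 : 0 <= (vol P)^-1 by rewrite invr_ge0 ltW// vol_gt0.
  rewrite ler_wpM2r//; apply: le_Rintegral.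
  - exact: measurable_ncube.
  - exact: (cube_integrable_normB _ (cube_integrable_norm If) P0).
  - exact: (cube_integrable_normB _ If P0).
  - by move=> y _; rewrite /dev ler_dist_dist.
by move: h; have := ler_norm (mean (fun x => `|f x|) P - `|c|); lra.
Qed.

Lemma mean_norm_hull P U (k M : R) : 0 < P.2 -> 0 < U.2 -> ncube P `<=` ncube U ->
  U.2 <= k * P.2 -> 0 <= k -> osc f U <= M ->
  mean (fun y => `|f y|) P <= k ^+ n * M + `|mean f U|.
Proof.
move=> P0 U0 PU UP k0 UM; apply: (le_trans (mean_norm_le (mean f U) P0)).
rewrite lerD2r; apply: (@le_trans _ _ (k ^+ n * osc f U)).
  by apply: mean_le_sub => //; [exact: cube_integrable_fdev|exact: fdev_ge0].
by rewrite ler_wpM2l// exprn_ge0.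
Qed.

Lemma dyadic_scale (l m : R) : 0 < l -> 0 < m -> m < l ->
  exists K : nat, l / 2 ^+ K <= m <= 2 * (l / 2 ^+ K).
Proof.
move=> l0 m0 ml.
have p2 K : 0 < 2 ^+ K :> R by rewrite exprn_gt0.
have ex : exists K : nat, l <= m * 2 ^+ K.
  exists (Num.truncn (l / m)).+1; rewrite mulrC -ler_pdivrMr//.
  apply: (le_trans (ltW (Num.Theory.truncnS_gt _))).
  by rewrite -natrX ler_nat ltnW// ltn_expl.
case: (ex_minnP ex) => -[|K]; first by rewrite expr0 mulr1 leNgt ml.
move=> h hmin; exists K.+1; rewrite ler_pdivrMr// h/=.
have : ~~ (l <= m * 2 ^+ K) by apply/negP => /hmin; rewrite ltnn.
rewrite -ltNge => /ltW; rewrite -ler_pdivlMr// => /le_trans; apply.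
by rewrite exprS invfM mulrCA (mulVKf (_ : 2 != 0 :> R)) ?pnatr_eq0.
Qed.

(** L is typically inf_Q Mf, and M the sharp maximal function at x.
    The factor 4 * 3 ^+ n bounds the sum of the three errors made in going from
    P to a common hull, from there to a dyadic cube u of similar size, and from
    u to Q: 2 ^+ n + 3 ^+ n + 2 ^+ n.+1 * c.+1 <= 4 * 3 ^+ n * c.+1. *)
Lemma mean_norm_le_path (z M L t : R) Q P x : 1 <= z -> 0 < Q.2 -> ncube Q x ->
  (forall T, 0 < T.2 -> ncube T x -> osc f T <= M) ->
  (forall U, Q.2 <= U.2 -> ncube Q `<=` ncube U -> mean (fun y => `|f y|) U <= L) ->
  (forall K (c : nat), z ^+ c <= leaf_fun (stopping f) z (fun=> 1) K Q Q x ->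
     4 * 3 ^+ n * c.+1%:R <= t) ->
  0 < P.2 -> ncube P x -> mean (fun y => `|f y|) P <= L + t * M.
Proof.
move=> z1 Q0 xQ oscM QL zt P0 xP.
have M0 : 0 <= M by apply: le_trans (oscM _ Q0 xQ); exact: osc_ge0.
have path K := @leaf_path z M x K Q Q z1 oscM Q0 Q0 xQ (@subset_refl _ _).
have {}path K : exists u c, [/\ 0 < u.2, u.2 = Q.2 / 2 ^+ K, ncube u x,
    4 * 3 ^+ n * c.+1%:R <= t &
    `|mean f u - mean f Q| <= 2 ^+ n.+1 * c.+1%:R * M].
  have [|u [c [[u0 uE xu] zc uc]]] := path K.
    by rewrite -[leLHS]/(osc f Q); have := osc_ge0 f Q0; lra.
  by exists u, c; split => //; exact: zt zc.
have normL U : Q.2 <= U.2 -> ncube Q `<=` ncube U -> `|mean f U| <= L.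
  move=> U1 QU; have U0 := lt_le_trans Q0 U1; apply: le_trans (QL U U1 QU).
  have := @mean_sub_le _ _ f 0 U If U0; rewrite subr0 => /le_trans; apply.
  rewrite le_eqVlt; apply/orP; left; apply/eqP; congr (_ / _).
  by apply: eq_Rintegral => y _; rewrite /dev subr0.
have e23 : 2 ^+ n <= 3 ^+ n :> R by rewrite lerXn2r ?nnegrE; lra.
have e2 : 0 <= 2 ^+ n :> R by rewrite exprn_ge0.
(* if P is larger than Q, the hull of P and Q contains Q *)
have [QP|PQ] := leP Q.2 P.2.
  have [U UE [PU QU]] := cube_hull xP xQ P0 Q0.
  have U0 : 0 < U.2 by rewrite UE addr_gt0.
  apply: (@le_trans _ _ (2 ^+ n * M + L)).
    apply: (@le_trans _ _ (2 ^+ n * M + `|mean f U|)); last first.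
      by rewrite lerD2l normL// UE lerDr ltW.
    apply: mean_norm_hull => //; first by rewrite UE; lra.
    exact: oscM U0 (PU _ xP).
  rewrite addrC lerD2l ler_wpM2r//.
  have [u [c [_ _ _ ct _]]] := path 0%N; apply: le_trans ct.
  have : 1 <= c.+1%:R :> R by rewrite ler1n.
  nra.
(* otherwise P is compared with a dyadic cube u of about the same side *)
have [K /andP[K1 K2]] := dyadic_scale Q0 P0 PQ.
have [u [c [u0 uE xu ct uc]]] := path K.
have [U UE [PU uU]] := cube_hull xP xu P0 u0.
have U0 : 0 < U.2 by rewrite UE addr_gt0.
have UM := oscM _ U0 (PU _ xP).
have h1 : mean (fun y => `|f y|) P <= 2 ^+ n * M + `|mean f U|.
  by apply: mean_norm_hull => //; rewrite UE uE; lra.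
have h2 : `|mean f u - mean f U| <= 3 ^+ n * M.
  apply: (le_trans (mean_sub_le _ If u0)).
  apply: (@le_trans _ _ (3 ^+ n * osc f U)); last by rewrite ler_wpM2l// exprn_ge0.
  apply: mean_le_sub => //; [exact: cube_integrable_fdev|exact: fdev_ge0|].
  by rewrite UE uE; lra.
have h3 := normL Q (lexx _) (@subset_refl _ _).
have h4 : `|mean f U| <= `|mean f u - mean f U| + `|mean f u - mean f Q| + `|mean f Q|.
  rewrite -[in leLHS](subrK (mean f Q) (mean f U)).
  apply: (le_trans (ler_normD _ _)); rewrite lerD2r.
  by rewrite (distrC (mean f u) (mean f U)); exact: ler_distD.
have h5 : (2 ^+ n + 3 ^+ n + 2 ^+ n.+1 * c.+1%:R) * M <= t * M.
  rewrite ler_wpM2r//; apply: le_trans ct; rewrite exprS.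
  have : 1 <= c.+1%:R :> R by rewrite ler1n.
  nra.
move: h5; rewrite !mulrDl; lra.
Qed.

End pointwise.

(** * Elementary inequalities *)

Lemma expR_le1D2x (R : realType) (y : R) : 0 <= y <= 1 / 2 -> expR y <= 1 + 2 * y.
Proof.
move=> /andP[y0 y1]; have := expR_ge1Dx (- y); rewrite expRN => h.
have e0 := expR_gt0 y.
have : (1 - y) * expR y <= 1 by rewrite -ler_pdivlMr// mul1r.
have : 1 <= (1 + 2 * y) * (1 - y) by nra.
have y2 : 0 < 1 - y by lra.
move=> h1 h2; rewrite -(ler_pM2l y2); apply: (le_trans h2).
by rewrite mulrC.
Qed.

Section ereal_quotient.
Context {R : realType}.
Local Open Scope ereal_scope.

Lemma leeB_real (a b : \bar R) (r : R) : 0 <= b -> a <= b + r%:E -> a - b <= r%:E.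
Proof.
case: b => [b| |]// _; last by move=> _; case: a => //= *; rewrite leNye.
by rewrite leeBlDr// addeC.
Qed.

(** The conclusion survives the degenerate cases of the division: a quotient by
    +oo is 0, and a nonpositive numerator divided by 0 is nonpositive. *)
Lemma divB_le (a b s : \bar R) (t : R) : 0 <= b -> 0 <= s -> (0 <= t)%R ->
  (s < +oo -> a <= b + t%:E * s) -> (a - b) / s <= t%:E.
Proof.
case: s => [s| |]//= b0 s0 t0 h; last by rewrite invey mule0.
have {}h := leeB_real b0 (h (ltry _)).
rewrite inver; case: eqP => [se|/eqP s1].
  rewrite se mulr0 in h; rewrite -[leRHS]adde0.
  by apply: (@le_trans _ _ 0); [exact: mule_le0_ge0|rewrite adde0 lee_fin].
have {}s0 : (0 < s)%R by rewrite lt_def s1.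
by rewrite lee_pdivrMr.
Qed.

End ereal_quotient.

(** * The exponential majorant *)

Section key.
Context {R : realType} {n : nat}.
Local Notation Rn := (Rn R n).
Local Notation mu := (@leb R n).
Local Notation node := (Rn * R)%type.
Implicit Types (v u S Q P U q : node) (x : Rn) (f w : Rn -> R).

(** The factor 4 * 3 ^+ n of mean_norm_le_path times 16, where 1 / (16 [w]) is a
    lower bound of the logarithm of growth_base. *)
Definition dim_const : R := 64 * 3 ^+ n.

Lemma dim_const_gt0 : 0 < dim_const.
Proof. by rewrite mulr_gt0 ?exprn_gt0. Qed.

Lemma Ainfty_constE f w : cube_integrable f -> weight w -> Ainfty w ->
  Ainfty_const w = (fine (Ainfty_const w))%:E.
Proof.
move=> If ww Aw; have := Ainfty_const_ge If ww Aw.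
by case: (Ainfty_const w) => [r| |]//= h; exfalso; lra.
Qed.

Lemma sharp_maximal_ge0 f x : cube_integrable f -> (0 <= sharp_maximal f x)%E.
Proof.
move=> If; pose v : node := ([tuple (tnth x i : R) | i < n], 1).
have xv : ncube v x by apply/ncubeP => i; rewrite /= tnth_mktuple; lra.
have v0 : 0 < v.2 by rewrite /=.
by apply: le_trans (sharp_maximal_ge If v0 xv); rewrite lee_fin osc_ge0.
Qed.

(** H is z^(N + 1).  L may be any upper bound of the averages of |f| over the
    cubes that contain q: the essential infimum of Mf over q is one, and
    mean_superset_bounded provides a finite one. *)
Lemma exponential_majorant f w q : cube_integrable f -> weight w -> Ainfty w -> 0 < q.2 ->
  exists H : Rn -> \bar R, [/\ measurable_fun [set: Rn] H,
    (forall x, 0 <= H x)%E, (forall x, ncube q x -> 1 <= H x)%E,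
    (\int[mu]_(x in ncube q) (H x * (absf w x)%:E) <= (2 * mass (absf w) q)%:E)%E &
    forall (L : \bar R) x (t : R),
      (forall U, q.2 <= U.2 -> ncube q `<=` ncube U ->
        ((mean (fun y => `|f y|) U)%:E <= L)%E) ->
      ncube q x -> (H x <= (expR (t / (dim_const * fine (Ainfty_const w))))%:E)%E ->
      (sharp_maximal f x < +oo)%E ->
      (maximal f x <= L + t%:E * sharp_maximal f x)%E].
Proof.
move=> If ww Aw q0; have [H [mH H0 powerH iH]] := stop_power_bound If ww Aw q0.
have z1 := growth_base_gt1 If ww Aw; have D2 := Ainfty_const_ge If ww Aw.
exists H; split => //.
  move=> x xq; apply: le_trans (powerH 0 x); rewrite lee_fin /stop_power /leaf_fun /=.
  by rewrite mul1r indicE mem_set// mulr1 ltW.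
move=> L x t qL xq Hx sx.
have sf : sharp_maximal f x \is a fin_num by rewrite ge0_fin_numE// sharp_maximal_ge0.
have := @sharp_maximal_ge _ _ f _ x If _ _.
rewrite -(fineK sf); set M := fine _ => oscM.
have {}oscM T : 0 < T.2 -> ncube T x -> osc f T <= M.
  by move=> T0 xT; rewrite -lee_fin; exact: oscM.
have := qL q (lexx _) (@subset_refl _ _).
case: L qL => [L qL _|qL _|qL]; last by rewrite leeNy_eq.
  2: by rewrite -EFinM addye; [exact: leey|].
rewrite -EFinM -EFinD; apply: maximal_le => // P P0 xP; rewrite lee_fin.
apply: (@mean_norm_le_path _ _ f If (growth_base w) M L t q P x) => //; first exact: ltW.
move=> K c zc.
have {}zc : growth_base w ^+ c.+1 <= expR (t / (dim_const * fine (Ainfty_const w))).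
  rewrite -lee_fin; apply: le_trans Hx; apply: le_trans (powerH K x).
  by rewrite lee_fin exprS ler_wpM2l// ltW// (lt_trans _ z1).
set D := fine _ in D2 zc.
(* expR_le1D2x applies since (16 * D)^-1 <= 1 / 8 *)
have ez : expR (16 * D)^-1 <= growth_base w.
  rewrite /growth_base -/D; have -> : (8 * D)^-1 = 2 * (16 * D)^-1 by field; lra.
  apply: expR_le1D2x; rewrite invr_ge0 (_ : 0 <= 16 * D); last by lra.
  by rewrite /= -[leRHS]invrK lef_pV2 ?posrE; lra.
have : expR (c.+1%:R * (16 * D)^-1) <= expR (t / (dim_const * D)).
  apply: le_trans zc; rewrite expRM_natl.
  by rewrite lerXn2r// nnegrE ?expR_ge0// ltW// (lt_trans _ z1).
rewrite ler_expR ler_pdivlMr ?mulr_gt0 ?dim_const_gt0//; last lra.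
have -> : c.+1%:R * (16 * D)^-1 * (dim_const * D) = 4 * 3 ^+ n * c.+1%:R.
  by rewrite /dim_const; field; lra.
by [].
Qed.

(** Such an average is a lower bound of Mf at every point of Q. *)
Lemma mean_le_ess_inf f U (Q : set Rn) (cQ : is_cube Q) : cube_integrable f -> 0 < U.2 ->
  Q `<=` ncube U -> ((mean (fun y => `|f y|) U)%:E <= ess_inf_cube cQ (maximal f))%E.
Proof.
move=> If U0 QU; apply/ess_infP; exists (~` Q); split.
- exact/measurableC/measurable_cube.
- by rewrite -[LHS]/(mu (~` Q `&` Q)) setICl measure0.
- by move=> x /= h Qx; apply: h; apply: maximal_ge => //; exact: QU.
Qed.

Lemma ess_inf_le_maximal_ae f (Q : set Rn) (cQ : is_cube Q) :
  {ae mu, forall x, Q x -> (ess_inf_cube cQ (maximal f) <= maximal f x)%E}.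
Proof.
have [N [mN N0 hN]] := ess_inf_le (mrestr mu (measurable_cube cQ)) (maximal f).
exists (N `&` Q); split.
- by apply: measurableI => //; exact: measurable_cube.
- exact: N0.
- by move=> x /= /not_implyP[Qx h]; split => //; exact: hN.
Qed.

(** A cube U containing q can be enlarged by a fixed length so as to contain a
    point where Mf is finite; since U is at least as large as q, this multiplies
    its volume by a bounded factor. *)
Lemma mean_superset_bounded f q : cube_integrable f -> ~ (forall x, maximal f x = +oo%E) ->
  0 < q.2 -> exists L : R, forall U, q.2 <= U.2 -> ncube q `<=` ncube U ->
    mean (fun y => `|f y|) U <= L.
Proof.
move=> If /existsNP[x /eqP Mx] q0.
have Mf : maximal f x \is a fin_num by rewrite ge0_fin_numE ?maximal_ge0// ltey.
(* S is a cube centred at the corner of q that is large enough to contain x *)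
pose d : R := 1 + \sum_(i < n) `|(tnth x i : R) - tnth q.1 i|.
have s0 : 0 <= \sum_(i < n) `|(tnth x i : R) - tnth q.1 i| by exact: sumr_ge0.
have d0 : 0 < d by rewrite /d; lra.
pose S : node := ([tuple (tnth q.1 i : R) - d | i < n], 2 * d).
have S0 : 0 < S.2 by rewrite /= mulr_gt0.
have qS : ncube S q.1 by apply/ncubeP => i; rewrite /= tnth_mktuple; lra.
have xS : ncube S x.
  apply/ncubeP => i; rewrite /= tnth_mktuple.
  have : `|(tnth x i : R) - tnth q.1 i| <= d.
    rewrite /d (bigD1 i)//= addrCA lerDl addr_ge0//.
    exact: sumr_ge0.
  by rewrite ler_norml => /andP[]; lra.
have qq : ncube q q.1 by apply/ncubeP => i; lra.
exists ((1 + 2 * d / q.2) ^+ n * fine (maximal f x)) => U qU sU.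
have U0 : 0 < U.2 by exact: lt_le_trans qU.
have [V VE [UV SV]] := cube_hull (sU _ qq) qS U0 S0.
have V0 : 0 < V.2 by rewrite VE addr_gt0.
have k0 : 0 <= 1 + 2 * d / q.2 by rewrite addr_ge0// divr_ge0//; lra.
apply: (@le_trans _ _ ((1 + 2 * d / q.2) ^+ n * mean (fun y => `|f y|) V)).
  apply: mean_le_sub => //; first exact: cube_integrable_norm.
  rewrite VE mulrDl mul1r lerD2l /= mulrAC ler_pdivlMr//.
  by rewrite ler_wpM2l//; lra.
rewrite ler_wpM2l ?exprn_ge0// -lee_fin fineK//.
by apply: maximal_ge => //; exact: SV.
Qed.

End key.

(** * Tail and norm estimates *)

Section estimates.
Context {R : realType} {n : nat}.
Local Notation Rn := (Rn R n).
Local Notation mu := (@leb R n).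
Local Notation node := (Rn * R)%type.
Variables (f w : Rn -> R) (q : node).
Hypotheses (If : cube_integrable f) (ww : weight w) (Aw : Ainfty w) (q0 : 0 < q.2).
Let D := fine (Ainfty_const w).
Let C := @dim_const R n.
Let D0 : 0 < D. Proof. have := Ainfty_const_ge If ww Aw; rewrite -/D; lra. Qed.
Let C0 : 0 < C := dim_const_gt0.
Let Iaw : cube_integrable (absf w).
Proof. by case: ww => /loc_integrable_cube_integrable Iw _; exact: cube_integrable_norm. Qed.

(** Chebyshev's inequality for H, since H > exp(t / (C [w])) on E. *)
Lemma exponential_tail (L : \bar R) (t : R) (E : set Rn) : 0 < t ->
  (forall U : node, q.2 <= U.2 -> ncube q `<=` ncube U ->
     ((mean (fun y => `|f y|) U)%:E <= L)%E) ->
  (forall x, E x -> [/\ ncube q x, (sharp_maximal f x < +oo)%E &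
     ~ (maximal f x <= L + t%:E * sharp_maximal f x)%E]) ->
  (wmeas w E <= 2%:E * expeR (- ((C^-1 * t)%:E / Ainfty_const w)) * wmeas w (ncube q))%E.
Proof.
move=> t0 qL hE.
have [H [mH H0 _ iH key]] := exponential_majorant If ww Aw q0.
pose s : R := t / (C * D).
have EH x : E x -> ((expR s)%:E <= H x)%E.
  move=> Ex; have [xq sx nM] := hE x Ex; rewrite leNgt; apply/negP => /ltW hx.
  exact/nM/key.
have mq := measurable_ncube q0.
have maw : measurable_fun (ncube q) (EFin \o absf w) := measurable_int _ (Iaw q0).
have -> : (expeR (- ((C^-1 * t)%:E / Ainfty_const w)) = (expR (- s))%:E)%E.
  rewrite (Ainfty_constE If ww Aw) -/D inver gt_eqF// -EFinM -EFinN /=.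
  have hs (a b c : R) : a^-1 * c / b = c / (a * b) by rewrite invfM; ring.
  by rewrite hs.
rewrite wmeas_ncube// -!EFinM.
apply: (@le_trans _ _ (\int[mu]_(x in ncube q) ((expR (- s))%:E * (H x * (absf w x)%:E)))%E).
  apply: le_integral_subset => [x /hE[]//|x Ex|x _]; last first.
    by rewrite mule_ge0 ?lee_fin ?expR_ge0// mule_ge0// lee_fin absf_ge0.
  apply: (@le_trans _ _ (absf w x)%:E); first by rewrite lee_fin ler_norm.
  rewrite muleA -[leLHS]mul1e lee_wpmul2r ?lee_fin ?absf_ge0//.
  rewrite -[leLHS]/(1%:E) -(expRxMexpNx_1 s) EFinM muleC.
  by rewrite lee_wpmul2l ?lee_fin ?expR_ge0// EH.
rewrite (@ge0_integralZl _ _ _ mu _ mq); last 3 first.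
- by apply: emeasurable_funM => //; exact: measurable_funS mH.
- by move=> x _; rewrite mule_ge0// lee_fin absf_ge0.
- by rewrite lee_fin expR_ge0.
rewrite -mulrA mulrCA [leRHS]EFinM; apply: lee_wpmul2l; last exact: iH.
by rewrite lee_fin expR_ge0.
Qed.

(** Here m plays the role of the essential infimum of Mf over the cube.  Where
    H(x) and M#f(x) are finite, Mf(x) is bounded by L + t M#f(x), so that m is
    finite too and the quotient g lies between 0 and C [w] ln H(x); where M#f(x)
    is infinite, g vanishes. *)
Lemma exponential_norm (m : \bar R) (L : R) :
  (forall U : node, q.2 <= U.2 -> ncube q `<=` ncube U ->
     ((mean (fun y => `|f y|) U)%:E <= m)%E) ->
  (forall U : node, q.2 <= U.2 -> ncube q `<=` ncube U -> mean (fun y => `|f y|) U <= L) ->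
  {ae mu, forall x, ncube q x -> (m <= maximal f x)%E} ->
  (expL_norm w (ncube q) (fun x => (maximal f x - m) / sharp_maximal f x)
    <= C%:E * Ainfty_const w)%E.
Proof.
move=> qm qL mM; have [H [mH H0 H1 iH key]] := exponential_majorant If ww Aw q0.
have mq := measurable_ncube q0.
have maw : measurable_fun (ncube q) (EFin \o absf w) := measurable_int _ (Iaw q0).
have W0 := mass_weight_gt0 ww q0.
have m0 : (0 <= m)%E.
  apply: le_trans (qm q (lexx _) (@subset_refl _ _)); rewrite lee_fin.
  by rewrite divr_ge0 ?mass_ge0// ltW// vol_gt0.
rewrite (Ainfty_constE If ww Aw) -/D -EFinM.
apply: ereal_inf_lbound; exists (C * D) => //; split; first by rewrite mulr_gt0.
pose k x : \bar R := ((absf w x)%:E * ((mass (absf w) q)^-1)%:E)%E.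
have k0 x : (0 <= k x)%E by rewrite mule_ge0// lee_fin ?absf_ge0// invr_ge0 ltW.
have mk : measurable_fun (ncube q) k by apply: emeasurable_funM => //; exact: measurable_cst.
have mHq : measurable_fun (ncube q) H by exact: measurable_funS mH.
have mH1 : measurable_fun (ncube q) (fun x => H x - 1)%E by exact: emeasurable_funB.
have H10 x : ncube q x -> (0 <= H x - 1)%E by move=> /H1; rewrite sube_ge0.
have mHk : measurable_fun (ncube q) (fun x => (H x - 1) * k x)%E by exact: emeasurable_funM.
apply: (@le_trans _ _ (\int[mu]_(x in ncube q) ((H x - 1) * k x))%E).
  apply: (@ae_le_integral_upper _ _ _ mu _ _ _ mq mHk).
    by move=> x xq; rewrite mule_ge0// H10.
  case: ww => _ w0; apply: filterS2 w0 mM => x wx mx xq; have {}mx := mx xq.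
  have -> : ((w x)%:E / wmeas w (ncube q) = k x)%E.
    by rewrite wmeas_ncube// inver gt_eqF// /k /absf gtr0_norm.
  rewrite lee_wpmul2r// leeB//.
  set g := ((maximal f x - m) / sharp_maximal f x)%E.
  have : H x = +oo%E \/ exists2 h : R, H x = h%:E & 1 <= h.
    move: (H1 x xq); case: (H x) => [h| |]//; last by left.
    by right; exists h.
  case=> [->|[h hE h1]]; first exact: leey.
  (* the t for which H x = exp(t / (C * D)) *)
  pose t := C * D * ln h.
  have t0 : 0 <= t by rewrite mulr_ge0 ?ln_ge0// ltW// mulr_gt0.
  have ht : (H x <= (expR (t / (C * D)))%:E)%E.
    rewrite hE lee_fin /t mulrC mulrA mulVf ?mul1r ?gt_eqF ?mulr_gt0//.
    by rewrite lnK// posrE (lt_le_trans _ h1).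
  have gt : (g <= t%:E)%E.
    apply: divB_le; [exact: m0|exact: sharp_maximal_ge0|exact: t0|].
    by move=> sx; apply: key.
  have g0 : (0 <= g)%E.
    have [sy|/eqP sy] := eqVneq (sharp_maximal f x) +oo%E.
      by rewrite /g sy invey mule0.
    rewrite /g mule_ge0 ?inve_ge0 ?sharp_maximal_ge0//.
    have sf : (sharp_maximal f x < +oo)%E by rewrite ltey; exact/eqP.
    have sfin : sharp_maximal f x \is a fin_num by rewrite ge0_fin_numE ?sharp_maximal_ge0.
    have Mfin : (maximal f x < +oo)%E.
      apply: (@le_lt_trans _ _ (L%:E + t%:E * sharp_maximal f x)%E).
        by apply: key => // U U1 U2; rewrite lee_fin; exact: qL.
      by rewrite -(fineK sfin) -EFinM -EFinD ltry.
    by rewrite sube_ge0// ?(ge0_fin_numE m0)// (le_lt_trans mx).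
  rewrite gee0_abs// hE inver gt_eqF ?mulr_gt0//.
  have gf : g \is a fin_num by rewrite ge0_fin_numE// (le_lt_trans gt)// ltry.
  rewrite -(fineK gf) -EFinM /= lee_fin.
  have gt' : fine g <= t by rewrite -lee_fin fineK.
  rewrite -[leRHS](@lnK _ h) ?posrE ?(lt_le_trans _ h1)// ler_expR.
  by rewrite ler_pdivrMr ?mulr_gt0// mulrC.
have ik : (\int[mu]_(x in ncube q) k x = 1)%E.
  rewrite /k; under eq_integral do rewrite muleC.
  rewrite (@ge0_integralZl _ _ _ mu _ mq); last 3 first.
  - exact: maw.
  - by move=> x _; rewrite lee_fin absf_ge0.
  - by rewrite lee_fin invr_ge0 ltW.
  by rewrite massE// -EFinM mulVf// gt_eqF.
have iHk : (\int[mu]_(x in ncube q) (H x * k x) <= 2%:E)%E.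
  rewrite /k; under eq_integral do rewrite muleA muleC.
  rewrite (@ge0_integralZl _ _ _ mu _ mq); last 3 first.
  - exact: emeasurable_funM.
  - by move=> x _; rewrite mule_ge0// lee_fin absf_ge0.
  - by rewrite lee_fin invr_ge0 ltW.
  rewrite muleC -lee_pdivlMr// ?invr_gt0//.
  by rewrite invrK -EFinM.
have : (\int[mu]_(x in ncube q) ((H x - 1) * k x) + \int[mu]_(x in ncube q) k x
   = \int[mu]_(x in ncube q) (H x * k x))%E.
  rewrite -(@ge0_integralD _ _ _ mu _ mq); last 4 first.
  - by move=> x xq; rewrite mule_ge0// H10.
  - exact: mHk.
  - by move=> x _; exact: k0.
  - exact: mk.
  apply: eq_integral => x /set_mem xq.
  rewrite -[X in (_ + X)%E]mul1e -ge0_muleDl ?H10//.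
  by rewrite subeK.
rewrite ik => e; rewrite -e in iHk; rewrite -(leeD2rE _ _ (_ : 1%E \is a fin_num))//.
Qed.

End estimates.

Local Open Scope ereal_scope.

Theorem corollary1p3 (R : realType) (n : nat) (n_gt0 : (0 < n)%N) :
  [/\ exists c1 c2 : R, [/\ (0 < c1)%R, (0 < c2)%R &
        forall f w : Rn R n -> R,
          loc_integrable f -> nonconstant f ->
          ~ (forall x, maximal f x = +oo) ->
          weight w -> Ainfty w ->
        forall t : R, (0 < t)%R ->
        forall (Q : set (Rn R n)) (cQ : is_cube Q),
          wmeas w [set x | Q x /\
              t%:E < (maximal f x - ess_inf_cube cQ (maximal f))
                     / sharp_maximal f x]
          <= c1%:E * expeR (- ((c2 * t)%:E / Ainfty_const w)) * wmeas w Q],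
      exists c : R, (0 < c)%R /\
        forall f w : Rn R n -> R,
          loc_integrable f -> nonconstant f ->
          ~ (forall x, maximal f x = +oo) ->
          weight w -> Ainfty w ->
        forall (Q : set (Rn R n)) (cQ : is_cube Q),
          expL_norm w Q (fun x =>
              (maximal f x - ess_inf_cube cQ (maximal f))
              / sharp_maximal f x)
          <= c%:E * Ainfty_const w &
      exists c1 c2 : R, [/\ (0 < c1)%R, (0 < c2)%R &
        forall f w : Rn R n -> R,
          loc_integrable f -> nonconstant f ->
          ~ (forall x, maximal f x = +oo) ->
          weight w -> Ainfty w ->
        forall (Q : set (Rn R n)) (cQ : is_cube Q) (lambda gamma : R),
          (0 < lambda)%R -> (0 < gamma)%R ->
          wmeas w [set x | [/\ Q x,
              lambda%:E <
                maximal f x - ess_inf_cube cQ (maximal f) &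
              sharp_maximal f x <= (gamma * lambda)%:E]]
          <= c1%:E * expeR (- (c2%:E / (Ainfty_const w * gamma%:E))) *
             wmeas w Q]].
Proof.
have C0 := @dim_const_gt0 R n; set C := @dim_const R n in C0.
have Ci : (0 < C^-1)%R by rewrite invr_gt0.
have mean_le f (q U : Rn R n * R) (cq : is_cube (ncube q)) : loc_integrable f ->
    (0 < q.2)%R -> (q.2 <= U.2)%R -> ncube q `<=` ncube U ->
    (mean (fun y => `|f y|)%R U)%:E <= ess_inf_cube cq (maximal f).
  move=> /loc_integrable_cube_integrable If q0 qU sU.
  by apply: mean_le_ess_inf => //; exact: lt_le_trans qU.
have ess_ge0 f (q : Rn R n * R) (cq : is_cube (ncube q)) : loc_integrable f ->
    (0 < q.2)%R -> 0 <= ess_inf_cube cq (maximal f).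
  move=> If q0; apply: le_trans (mean_le f q q cq If q0 (lexx _) (@subset_refl _ _)).
  by rewrite lee_fin divr_ge0 ?mass_ge0// ltW// vol_gt0.
split.
- exists 2%R, C^-1%R; split => // f w fl _ _ ww Aw t t0 Q cQ.
  have If := loc_integrable_cube_integrable fl.
  have [q q0 Qq] := is_cubeP cQ; move: cQ; rewrite Qq => cq {Qq Q}.
  apply: (exponential_tail If ww Aw q0 (L := ess_inf_cube cq (maximal f)) t0).
    by move=> U; exact: mean_le.
  move=> x /= [xq tx]; split; first exact: xq.
    rewrite ltey; apply/eqP => sx; move: tx.
    by rewrite sx invey mule0 lte_fin ltNge (ltW t0).
  move=> h; move: tx; rewrite ltNge => /negP; apply; apply: divB_le => //.
  - exact: ess_ge0.
  - exact: sharp_maximal_ge0.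
  - exact: ltW.
- exists C; split => // f w fl _ Moo ww Aw Q cQ.
  have If := loc_integrable_cube_integrable fl.
  have [q q0 Qq] := is_cubeP cQ; move: cQ; rewrite Qq => cq {Qq Q}.
  have [L hL] := mean_superset_bounded If Moo q0.
  apply: (exponential_norm If ww Aw q0 _ hL).
    by move=> U; exact: mean_le.
  exact: ess_inf_le_maximal_ae.
- exists 2%R, C^-1%R; split => // f w fl _ _ ww Aw Q cQ la ga la0 ga0.
  have If := loc_integrable_cube_integrable fl.
  have [q q0 Qq] := is_cubeP cQ; move: cQ; rewrite Qq => cq {Qq Q}.
  have gi : (0 < ga^-1)%R by rewrite invr_gt0.
  have D0 : (0 < fine (Ainfty_const w))%R by have := Ainfty_const_ge If ww Aw; lra.
  have -> : (C^-1)%:E / (Ainfty_const w * ga%:E) = (C^-1 * ga^-1)%:E / Ainfty_const w.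
    rewrite (Ainfty_constE If ww Aw) -EFinM !inver !gt_eqF ?mulr_gt0// -!EFinM.
    by rewrite (invfM (fine _) ga) mulrA mulrAC.
  apply: (exponential_tail If ww Aw q0 (L := ess_inf_cube cq (maximal f)) gi).
    by move=> U; exact: mean_le.
  move=> x /= [xq lx sx]; split; [exact: xq|exact: le_lt_trans sx (ltry _)|].
  move=> h; move: lx; rewrite ltNge => /negP; apply.
  apply: leeB_real; first exact: ess_ge0.
  apply: (le_trans h); apply: leeD2l.
  apply: (@le_trans _ _ ((ga^-1)%:E * (ga * la)%:E)).
    by apply: lee_wpmul2l => //; rewrite lee_fin ltW.
  by rewrite -EFinM mulKf// gt_eqF.
Qed.
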